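(* Let $\mathfrak g$ be a finite-dimensional semisimple Lie algebra over $\mathbb C$, and let $P_u$ be a meromorphic (at $u=0$) $\operatorname{End}\mathfrak g$-valued solution of the operator classical Yang--Baxter equation $$P_{u+v}([x,P^*_u(y)]) - P_v([P_u(x),y])+[P_{u+v}(x),P_v(y)]=0,\qquad x,y\in\mathfrak g .$$ Define $T_\lambda = \operatorname{Res}_{u=0} P_u \exp(\lambda u) \in (\operatorname{End} \mathfrak g)[\lambda ]$. Then $$T_{\lambda+\mu}([T_\lambda (x),y]) = [T_\lambda (x), T_\mu(y)] \quad\text{in } \mathfrak g[\lambda, \mu ]$$ for all $x,y\in \mathfrak g$.
   Context: All spaces are over $\mathbb C$. $\operatorname{End}\mathfrak g$ denotes the space of all linear maps $\mathfrak g\to\mathfrak g$, and for $P\in\operatorname{End}\mathfrak g$, $P^*$ denotes the adjoint of $P$ with respect to the Killing form of $\mathfrak g$ (non-degenerate since $\mathfrak g$ is semisimple). ''Meromorphic at $u=0$'' means: there is a neighbourhood $\mathcal D\subset\mathbb C$ of the origin such that $P_u$ is given on $\mathcal D\setminus\{0\}$ by a convergent Laurent series with finite singular part, $$P_u = \frac{1}{u^{N+1}} T_N + \dots + \frac{1}{u}T_0 + (\text{holomorphic in } u\in\mathcal D), \quad T_k\in \operatorname{End} \mathfrak g .$$ The equation is required to hold whenever $u,v,u+v\in\mathcal D\setminus\{0\}$. Here $\lambda,\mu$ are formal variables; explicitly $T_\lambda=\sum_{n=0}^N \frac{\lambda^n}{n!}T_n$. The map $T_\lambda:\mathfrak g\to\mathfrak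 g[\lambda]$ is extended linearly in the polynomial variables, and the bracket of $\mathfrak g$ is extended to $\mathfrak g[\lambda,\mu]$ by $\mathbb C[\lambda,\mu]$-bilinearity. *)

(* Defs.v *)
(* The complex field is R[i] for R : realType; its modulus topology is attached
   by the library to the regular module R[i]^o. *)
From HB Require Import structures.
From mathcomp Require Import all_boot all_order all_algebra.
From mathcomp Require Import all_classical all_reals.
From mathcomp Require Import topology normedtype.
From mathcomp Require Import complex.

Set Implicit Arguments.
Unset Strict Implicit.
Unset Printing Implicit Defensive.

Import Order.TTheory GRing.Theory Num.Theory.
Import numFieldNormedType.Exports.

Local Open Scope classical_set_scope.
Local Open Scope ring_scope.

HB.mixin Record isLieAlgebra (K : fieldType) g of Vector K g := {
  lie : g -> g -> g;
  lie_linearl : forall y : g, linear (fun x => lie x y);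
  lie_linearr : forall x : g, linear (lie x);
  lie_alt : forall x : g, lie x x = 0;
  lie_jacobi : forall x y z : g,
    lie x (lie y z) + lie y (lie z x) + lie z (lie x y) = 0
}.

#[short(type="lieAlgType")]
HB.structure Definition LieAlgebra (K : fieldType) :=
  { g of isLieAlgebra K g & Vector K g }.

Section LieTheory.
Variables (K : fieldType) (g : lieAlgType K).
Implicit Types (U V I : {vspace g}) (x y : g) (f : 'End(g)).

(* [U, V]; by bilinearity, brackets of basis elements span it. *)
Definition lie_span U V : {vspace g} :=
  <<[seq lie x y | x <- vbasis U, y <- vbasis V]>>%VS.

Definition lie_ideal I : Prop := (lie_span fullv I <= I)%VS.

Definition lie_solvable I : Prop :=
  exists n, iter n (fun U => lie_span U U) I = 0%VS.

Definition semisimple : Prop :=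
  forall I, lie_ideal I -> lie_solvable I -> I = 0%VS.

Definition ad x : 'End(g) := linfun (lie x).

Definition killing x y : K := 
  \tr (passmx.mxof (vbasis fullv) (vbasis fullv) (ad x \o ad y)%VF).

(* The Killing adjoint f^*, unique when the Killing form is nondegenerate;
   a default value if no adjoint exists. *)
Definition adjoint f : 'End(g) :=
  xget 0 [set h : 'End(g) | forall x y, killing (f x) y = killing x (h y)].

End LieTheory.

(* g[lambda, mu] = g (x) K[lambda, mu] is represented by row vectors over
   K[lambda, mu], in the coordinates of the basis [vbasis fullv] of g.
   K[lambda, mu] is {poly {poly K}}, lambda being the inner variable and mu the
   outer one. *)
Section PolynomialExtension.
Variables (K : fieldType) (g : lieAlgType K).

Local Notation A := {poly {poly K}}.
Local Notation n := (\dim (fullv : {vspace g})).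
Local Notation e := (vbasis (fullv : {vspace g})).

Definition lambda : A := 'X%:P.
Definition mu : A := 'X.

Definition polyLie := 'rV[A]_n.

Definition ext_incl (x : g) : polyLie := \row_i (coord e i x)%:P%:P.

Definition ext_lin (f : g -> g) (a : polyLie) : polyLie :=
  \sum_(i < n) a 0 i *: ext_incl (f e`_i).

Definition ext_lie (a b : polyLie) : polyLie :=
  \sum_(i < n) \sum_(j < n) (a 0 i * b 0 j) *: ext_incl (lie e`_i e`_j).

(* The value at l of \sum_(k <= N) 'X^k T_k in (End g)['X], extended
   K[lambda, mu]-linearly to g[lambda, mu]. *)
Definition ext_poly (T : nat -> 'End(g)) (N : nat) (l : A) (a : polyLie) :
    polyLie :=
  \sum_(k < N.+1) l ^+ k *: ext_lin (T k) a.

End PolynomialExtension.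

Section Meromorphic.
Variables (R : realType) (g : lieAlgType R[i]).
Local Notation C := R[i].

(* Convergence in the finite-dimensional space End g, tested on the matrix
   coefficients f |-> phi (f x). *)
Definition End_cvg (F : nat -> 'End(g)) (f : 'End(g)) : Prop :=
  forall (x : g) (phi : {linear g -> C^o}),
    (fun m => phi (F m x)) @ \oo --> phi (f x).

(* On D minus the origin,
   P u = \sum_(k <= N) u^-(k+1) T_k + \sum_(k >= 0) u^k H_k. *)
Definition laurent_on (D : set C) (N : nat) (T H : nat -> 'End(g))
    (P : C -> 'End(g)) : Prop :=
  forall u, D u -> u != 0 ->
    End_cvg (fun m => \sum_(k < N.+1) u ^- k.+1 *: T k
                      + \sum_(k < m) u ^+ k *: H k) (P u).

Definition meromorphic_on (D : set C) (N : nat) (P : C -> 'End(g)) : Prop :=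
  exists T H, laurent_on D N T H P.

(* Res_(u = 0) P u, by uniqueness of the Laurent coefficients. *)
Definition residue (P : C -> 'End(g)) : 'End(g) :=
  xget 0 [set r | exists (D : set C) N T H,
    [/\ nbhs (0 : C^o) D, laurent_on D N T H P & r = T 0%N]].

(* The coefficient of lambda^n in Res_(u = 0) P u exp(lambda u), where
   exp(lambda u) = \sum_n lambda^n u^n / n!; it is 0 for n > N if P has a pole
   of order at most N + 1. *)
Definition res_exp (P : C -> 'End(g)) (n : nat) : 'End(g) :=
  residue (fun u => (u ^+ n / n`!%:R) *: P u).

Definition CYBE_on (D : set C) (P : C -> 'End(g)) : Prop :=
  forall u v, D u -> D v -> D (u + v) -> u != 0 -> v != 0 -> u + v != 0 ->
  forall x y : g,
    P (u + v) (lie x (adjoint (P u) y)) - P v (lie (P u x) y)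
      + lie (P (u + v) x) (P v y) = 0.

End Meromorphic.

(* Main.v *)
Require Import Defs.
From HB Require Import structures.
From mathcomp Require Import all_boot all_order all_algebra.
From mathcomp Require Import all_classical all_reals.
From mathcomp Require Import topology normedtype sequences.
From mathcomp Require Import complex.
From mathcomp Require Import zify ring.
Import Order.TTheory GRing.Theory Num.Theory.
Import numFieldNormedType.Exports.
Local Open Scope classical_set_scope.
Local Open Scope ring_scope.

Set Implicit Arguments.
Unset Strict Implicit.
Unset Printing Implicit Defensive.

(** Put u = (1 - z) w, v = z w in the equation and expand at w = 0 for fixed z.
    Every coefficient of w^s with s < 0 is a rational function of z, with poles
    at 0 and 1 only, that vanishes identically. Its first term, the one with
    P^*, is regular at z = 0, so the polar part at z = 0 relates the other two
    terms and gives, with T_k = 0 for k > N,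
      sum_m binom(i, m) T_(j + m) [T_(i - m) x, y] = [T_i x, T_j y],
    which is the coefficient of lambda^i mu^j of the claim, up to i! j!. Only
    finite-order asymptotics of P at 0 are needed.

    For P^*_u to have an expansion, the Killing form must be nondegenerate. Let I
    be its radical and x in [I, g]. The complex conjugate D of the semisimple part
    of ad x is a derivation, and tr (ad x D), the sum of the squared moduli of the
    eigenvalues of ad x, is a sum of terms killing(u, D v) with u in I. So ad x is
    nilpotent, and by Engel's theorem [I, g], if nonzero, has a nonzero center,
    which is an abelian ideal of g. Hence [I, g] = 0 and I itself is abelian. *)

(** * Complex conjugate of the semisimple part *)

Section Interpolation.
Variable K : fieldType.
Implicit Types (s : seq K) (p q : {poly K}).

Lemma coprimep_XsubC_exp (a b : K) n m :
  a != b -> coprimep (('X - a%:P) ^+ n) (('X - b%:P) ^+ m).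
Proof.
by move=> ab; rewrite coprimep_expl ?coprimep_expr ?coprimep_XsubC2 // subr_eq0 eq_sym.
Qed.

Lemma coprimep_XsubC_exp_prod (a : K) s n m : a \notin s ->
  coprimep (('X - a%:P) ^+ n) (\prod_(b <- s) ('X - b%:P) ^+ m).
Proof.
elim: s => [|b s IHs]; first by rewrite big_nil coprimep1.
rewrite inE negb_or big_cons coprimepMr => /andP[ab /IHs ->].
by rewrite coprimep_XsubC_exp.
Qed.

(** Chinese remaindering, one node at a time: adding a multiple of the product [Q] over the earlier
    nodes keeps their congruences, and a Bezout relation between [('X - a%:P) ^+ n] and [Q] corrects
    the value at the new node. *)
Lemma hermite_interpolation (c : K -> K) (n : nat) s : uniq s ->
  exists p, forall a, a \in s -> ('X - a%:P) ^+ n %| p - (c a)%:P.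
Proof.
elim: s => [|a s IHs] /=; first by exists 0.
case/andP=> as_ /IHs[p Hp].
have /Bezout_eq1_coprimepP[[u w] /= uw1] := coprimep_XsubC_exp_prod n n as_.
set Q := \prod_(b <- s) _ in uw1.
exists (p + ((c a)%:P - p) * (w * Q)) => b; rewrite inE => /predU1P[->|bs].
  have ->: p + ((c a)%:P - p) * (w * Q) - (c a)%:P
     = (p - (c a)%:P) * u * ('X - a%:P) ^+ n.
    rewrite -mulrA (_ : u * _ = 1 - w * Q); last by rewrite -uw1 addrK.
    by ring.
  exact: dvdp_mull.
rewrite addrAC dvdp_add ?Hp //; apply/dvdp_mull/dvdp_mull.
by rewrite /Q (big_rem b) //= dvdp_mulr.
Qed.

End Interpolation.

Lemma horner_mx_trig (R : comNzRingType) n (T : 'M[R]_n.+1) p :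
  is_trig_mx T -> is_trig_mx (horner_mx T p) /\
  forall i, horner_mx T p i i = p.[T i i].
Proof.
move=> /is_trig_mxP Ttrig; elim/poly_ind: p => [|p c [/is_trig_mxP IH1 IH2]].
  by rewrite rmorph0; split=> [|i]; rewrite ?mx0_is_trig // mxE horner0.
rewrite rmorphD rmorphM /= horner_mx_X horner_mx_C -mulmxE; split=> [|i].
  apply/is_trig_mxP=> i j ij; rewrite !mxE big1 ?add0r => [|k _].
    by rewrite -val_eqE ltn_eqF.
  have [ik|ki] := ltnP i k; first by rewrite IH1 // mul0r.
  by rewrite Ttrig ?mulr0 // (leq_ltn_trans ki).
rewrite !mxE eqxx hornerMXaddC -IH2 (bigD1 i) //= big1 ?addr0 // => k ki.
have [ik|ik] := ltnP i k; first by rewrite IH1 // mul0r.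
by rewrite Ttrig ?mulr0 // ltn_neqAle ki.
Qed.

Section ConjReplica.
Variables (C : numClosedFieldType).

Lemma trigonalization n (M : 'M[C]_n.+1) : exists P T : 'M_n.+1,
  [/\ P \in unitmx, is_trig_mx T & M = invmx P *m T *m P].
Proof.
have [P Pu] := Schur M (ltn0Sn n); rewrite /similar_to /= => Ttrig.
have uP := unitarymx_unit Pu; exists P, (P *m M *m invmx P); split=> //.
  by move: Ttrig; rewrite (conjumx _ uP).
by rewrite !mulmxA mulVmx // mul1mx mulmxKV.
Qed.

(* [horner_mx M p] is the complex conjugate of the semisimple part of [M]. *)
Lemma conj_replica n (M : 'M[C]_n.+1) : exists p : {poly C}, exists2 q : seq C,
  uniq q /\ horner_mx M (\prod_(a <- q) ('X - a%:P) ^+ n.+1) = 0 &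
  (forall a, a \in q -> ('X - a%:P) ^+ n.+1 %| p - (a^*)%:P) /\
  (\tr (M *m horner_mx M p) = 0 -> M ^+ n.+1 = 0).
Proof.
have [P [T [uP Ttrig defM]]] := trigonalization M.
pose q := undup [seq T i i | i : 'I_n.+1].
have [p Hp] := hermite_interpolation (fun a => a^*) n.+1 (undup_uniq _ : uniq q).
have Tq i : T i i \in q by rewrite mem_undup; apply: fintype.image_f.
have hM r : horner_mx M r = invmx P *m horner_mx T r *m P.
  by rewrite defM horner_mx_uconjC.
exists p, q; [split; first exact: undup_uniq | split=> // tr0].
  rewrite hM (_ : horner_mx T _ = 0) ?mulmx0 ?mul0mx //.
  (* No eigenvalue has multiplicity above [n.+1], so the product over the distinct ones is a
     multiple of the characteristic polynomial. *)
  suff /dvdpP[r ->]: char_poly T %| \prod_(a <- q) ('X - a%:P) ^+ n.+1.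
    by rewrite rmorphM /= Cayley_Hamilton mulr0.
  rewrite char_poly_trig //.
  have ->: \prod_(i < n.+1) ('X - (T i i)%:P)
    = \prod_(a <- q) \prod_(i < n.+1 | T i i == a) ('X - a%:P).
    rewrite (exchange_big_dep xpredT) //=; apply: eq_bigr => i _.
    rewrite -big_filter (_ : [seq _ <- _ | _] = [:: T i i]) ?big_seq1 //.
    rewrite (eq_filter (a2 := pred1 (T i i))); last by move=> a; rewrite /= eq_sym.
    by rewrite filter_pred1_uniq ?undup_uniq.
  elim/big_ind2: _ => [|*|a _]; rewrite ?dvd1p ?dvdp_mul //.
  rewrite prodr_const dvdp_exp2l //.
  by rewrite (leq_trans (max_card _)) ?card_ord.
have T0 i : T i i = 0.
  (* Up to conjugation by [P] this is the trace of the triangular matrix ['X * p] at [T], with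
     diagonal entries [a * a^*]; being nonnegative, they vanish with their sum. *)
  have trE : \tr (M *m horner_mx M p) = \sum_i `|T i i| ^+ 2.
    rewrite hM defM !mulmxA mulmxK // -!mulmxA mxtrace_mulC -!mulmxA mulmxV // mulmx1.
    rewrite mulmxE -[X in X * _]horner_mx_X -rmorphM /=.
    apply: eq_bigr => j _; rewrite (horner_mx_trig _ Ttrig).2 hornerM hornerX.
    rewrite normCK; congr (_ * _).
    have /dvdpP[r /(congr1 (horner^~ (T j j)))] := Hp _ (Tq j).
    rewrite !hornerE subrr expr0n mulr0 => /eqP.
    by rewrite subr_eq0 => /eqP.
  move/eqP: tr0; rewrite trE psumr_eq0; last by move=> j _; rewrite exprn_ge0.
  by move/allP/(_ i (mem_index_enum i)); rewrite /= expf_eq0 /= normr_eq0 => /eqP.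
have -> : M ^+ n.+1 = horner_mx M ('X ^+ n.+1) by rewrite rmorphXn /= horner_mx_X.
rewrite hM.
rewrite (_ : 'X ^+ n.+1 = char_poly T) ?Cayley_Hamilton ?mulmx0 ?mul0mx //.
rewrite char_poly_trig // (eq_bigr (fun=> 'X)) ?prodr_const ?card_ord // => i _.
by rewrite T0 subr0.
Qed.

End ConjReplica.

Section ConjReplicaEnd.
Variable C : numClosedFieldType.
Import passmx.

(* [horner_mx] needs a positive dimension, hence the abstract evaluation [h]. *)
Lemma conj_replica_mx n (M : 'M[C]_n) : exists h : {poly C} -> 'M[C]_n,
  [/\ forall r s, h (r + s) = h r + h s,
      forall r s, h (r * s) = h r *m h s,
      forall c, h c%:P = c%:M,
      h 'X = M
    & exists N (p : {poly C}) (q : seq C),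
      [/\ uniq q,
          h (\prod_(a <- q) ('X - a%:P) ^+ N) = 0,
          forall a, a \in q -> ('X - a%:P) ^+ N %| p - (a^*)%:P
        & \tr (M *m h p) = 0 -> h ('X ^+ N) = 0]].
Proof.
case: n M => [|n] M.
  exists (fun=> 0); split=> [r s|r s|c||]; try by apply/matrixP=> -[].
  by exists 0%N, 0, [::]; split.
exists (horner_mx M); split; [exact: rmorphD | exact: rmorphM |
  exact: horner_mx_C | exact: horner_mx_X |].
have [p [q [uq q0] [pq tr0]]] := conj_replica M.
exists n.+1, p, q; split=> // /tr0 M0.
by rewrite rmorphXn /= horner_mx_X.
Qed.

Variable V : vectType C.
Local Notation e := (vbasis (fullv : {vspace V})).
Let eP : basis_of fullv e := vbasisP fullv.


(** [D] is [p] evaluated at [f]. The second clause says, as an induction principle, that [V] is the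
    sum of the generalized eigenspaces of [f], so that linear identities can be checked on them. *)
Lemma conj_replica_End (f : 'End(V)) :
  exists D : 'End(V),
  [/\ forall a k v, iter k (fun u => f u - a *: u) v = 0 -> D v = a^* *: v,
      forall Q : V -> Prop, Q 0 -> (forall u v, Q u -> Q v -> Q (u + v)) ->
        (forall a k v, iter k (fun u => f u - a *: u) v = 0 -> Q v) ->
        forall v, Q v
    & \tr (mxof e e (f \o D)%VF) = 0 -> exists k, forall v, iter k f v = 0].
Proof.
have [h [hD hM hC hX [N [p [q [uq qM pq trM]]]]]] := conj_replica_mx (mxof e e f).
pose act r : 'End(V) := hommx e e (h r).
have actD r s v : act (r + s) v = act r v + act s v.
  by rewrite /act hD linearD lfunE.
have actM r s v : act (r * s) v = act r (act s v).
  (* Matrices act on row vectors, so their products compose in reverse order; commutativity of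
     polynomials restores it. *)
  by rewrite mulrC /act hM (hommx_mul eP eP eP) lfunE.
have actC c v : act c%:P v = c *: v.
  by rewrite /act hC -scalemx1 linearZ /= (hommx1 eP) !lfunE /= lfunE.
have actN r v : act (- r) v = - act r v.
  by rewrite -mulN1r -[- 1]/(- 1%:P) -polyCN actM actC scaleN1r.
have act1 v : act 1 v = v by rewrite -[1]/(1%:P) actC scale1r.
have act0 v : act 0 v = 0 by rewrite -[0 in LHS]/(0%:P) actC scale0r.
have actX v : act 'X v = f v by rewrite /act hX (mxofK eP eP).
have actXa a k v : act (('X - a%:P) ^+ k) v = iter k (fun u => f u - a *: u) v.
  elim: k => [|k IHk] /=; first by rewrite expr0 act1.
  by rewrite exprS actM actD actN actC actX IHk.
have acq v : act (\prod_(a <- q) ('X - a%:P) ^+ N) v = 0.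
  by rewrite /act qM linear0 lfunE.
exists (act p); split=> [a k v|Q Q0 QD Qa|tr0].
- rewrite -actXa => kv; case: (boolP (a \in q)) => aq; last first.
    have /Bezout_eq1_coprimepP[[u w] /= uw1] := coprimep_XsubC_exp_prod k N aq.
    have -> : v = 0 by rewrite -[v]act1 -uw1 actD !actM kv acq !linear0 addr0.
    by rewrite linear0 scaler0.
  have ncop : a \notin rem a q by rewrite mem_rem_uniqF.
  have /Bezout_eq1_coprimepP[[u w] /= uw1] := coprimep_XsubC_exp_prod k N ncop.
  have av : act (('X - a%:P) ^+ N) v = 0.
    rewrite -[v]act1 -uw1 [act (_ + _) v]actD linearD /= actM kv linear0 linear0 add0r.
    rewrite -actM mulrCA actM; move: (acq v); rewrite (big_rem a) //= => ->.
    by rewrite linear0.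
  have /dvdpP[r pE] := pq _ aq.
  by rewrite -actC -[p](subrK (a^*)%:P) actD pE actM av linear0 add0r.
(* A Bezout relation splits [v] into a part killed by the remaining factors and a generalized
   eigenvector for [a]. *)
- suff spanQ s : uniq s -> forall v, act (\prod_(a <- s) ('X - a%:P) ^+ N) v = 0 -> Q v.
    by move=> v; apply: (spanQ _ uq); apply: acq.
  elim: s => [_ v|a s IHs /= /andP[as_ us] v]; first by rewrite big_nil act1 => ->.
  rewrite big_cons => qv.
  have /Bezout_eq1_coprimepP[[u w] /= uw1] := coprimep_XsubC_exp_prod N N as_.
  rewrite -[v]act1 -uw1 actD; apply: QD.
    by apply: IHs => //; rewrite -actM mulrCA (mulrC (\prod_(_ <- _) _)) actM qv linear0.
  by apply: (Qa a N); rewrite -actXa -actM mulrCA actM qv linear0.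
- have /trM XN : \tr (mxof e e f *m h p) = 0.
    by rewrite -tr0 (mxof_comp _ _ eP) (hommxK eP eP) mxtrace_mulC.
  exists N => v; rewrite -(_ : act ('X ^+ N) v = iter N f v).
    by rewrite /act XN linear0 lfunE.
  elim: (N) => [|k IHk] /=; first by rewrite expr0 act1.
  by rewrite exprS actM actX IHk.
Qed.

End ConjReplicaEnd.

(** * Lie algebras and Cartan's criterion *)

(** A subspace inside [Q] is enlarged by one vector at a time; its dimension cannot exceed that of
    [V], so it ends up being all of [Q]. *)
Lemma pred_vspace (K : fieldType) (V : vectType K) (Q : V -> Prop) :
  Q 0 -> (forall a u v, Q u -> Q v -> Q (a *: u + v)) ->
  exists U : {vspace V}, forall v, v \in U <-> Q v.
Proof.
move=> Q0 QL.
have grow m : exists U : {vspace V}, (forall v, v \in U -> Q v) /\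
    ((forall v, Q v -> v \in U) \/ (m <= \dim U)%N).
  elim: m => [|m [U [UQ [QU|mU]]]].
  - by exists 0%VS; split=> [v|]; [rewrite memv0 => /eqP-> | right].
  - by exists U; split=> //; left.
  have [QU|] := pselect (forall v, Q v -> v \in U); first by exists U; split=> //; left.
  move/existsNP=> [v /not_implyP[Qv /negP vU]].
  exists (<[v]> + U)%VS; split=> [_ /memv_addP[_ /vlineP[a ->] [u uU ->]]|].
    by apply: QL => //; apply: UQ.
  right; apply: leq_ltn_trans mU _.
  rewrite ltn_neqAle dimvS ?addvSr // andbT; apply: contra vU => /eqP dimE.
  have /eqP -> : (U == <[v]> + U)%VS by rewrite eqEdim addvSr dimE leqnn.
  by rewrite -[X in X \in _]addr0 memv_add ?memv_line ?mem0v.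
have [U [UQ [QU|]]] := grow (dim V).+1; first by exists U => v; split=> [/UQ|/QU].
by rewrite ltnNge -dimvf dimvS // subvf.
Qed.

Section LieBasics.
Variables (K : fieldType) (g : lieAlgType K).
Implicit Types (x y z : g) (f h : 'End(g)) (U V W I J : {vspace g}).

HB.instance Definition _ x :=
  GRing.isLinear.Build K g g *:%R (lie x) (lie_linearr x).

Lemma adE x y : ad x y = lie x y.
Proof. by rewrite lfunE. Qed.

Fact ad_is_linear : linear (@ad K g).
Proof.
move=> a x y; apply/lfunP=> z; rewrite !lfunE /= lfunE /= !adE.
exact: (lie_linearl z a x y).
Qed.
HB.instance Definition _ := GRing.isLinear.Build K g 'End(g) *:%R (@ad K g) ad_is_linear.

Lemma lieDl x y z : lie (x + y) z = lie x z + lie y z.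
Proof. by rewrite -!adE linearD lfunE. Qed.
Lemma lieZl a x z : lie (a *: x) z = a *: lie x z.
Proof. by rewrite -!adE linearZ lfunE. Qed.
Lemma lie0l z : lie 0 z = 0 :> g.
Proof. by rewrite -adE linear0 lfunE. Qed.
Lemma lieDr x y z : lie x (y + z) = lie x y + lie x z.
Proof. exact: linearD. Qed.
Lemma lieZr a x z : lie x (a *: z) = a *: lie x z.
Proof. exact: linearZ. Qed.
Lemma lie_suml (T : Type) (r : seq T) (F : T -> g) z :
  lie (\sum_(i <- r) F i) z = \sum_(i <- r) lie (F i) z.
Proof. by rewrite -adE linear_sum sum_lfunE; apply: eq_bigr => i _; rewrite adE. Qed.

Lemma lie_anti x y : lie x y = - lie y x.
Proof.
apply/eqP; rewrite -addr_eq0; apply/eqP.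
have := lie_alt (x + y); rewrite lieDl !linearD /= !lie_alt add0r addr0.
by rewrite addrC.
Qed.

Lemma lie_lie x y z : lie x (lie y z) = lie (lie x y) z + lie y (lie x z).
Proof.
have := lie_jacobi x y z; rewrite (lie_anti z x) linearN /= (lie_anti z) => /eqP.
by rewrite subr_eq0 => /eqP <-; rewrite subrK.
Qed.

Lemma ad_lie x y : ad (lie x y) = (ad x \o ad y)%VF - (ad y \o ad x)%VF.
Proof.
apply/lfunP=> z; rewrite !lfunE /= !lfunE /= !lfunE /= !adE.
by rewrite (lie_lie x y z) addrK.
Qed.

Lemma mem_lie_span U V u v : u \in U -> v \in V -> lie u v \in lie_span U V.
Proof.
move=> /coord_vbasis -> /coord_vbasis ->; rewrite lie_suml.
apply: memv_suml => i _; rewrite linear_sum; apply: memv_suml => j _.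
rewrite /= lieZl linearZ /= !memvZ // memv_span //.
by apply: allpairs_f; rewrite mem_nth // size_tuple.
Qed.

Lemma lie_span_sub U V W :
  (forall u v, u \in U -> v \in V -> lie u v \in W) -> (lie_span U V <= W)%VS.
Proof.
move=> UVW; apply/span_subvP=> _ /allpairsP[[u v] [/= uU vV ->]].
by apply: UVW; apply: vbasis_mem.
Qed.

Lemma lie_span_ind U V (Q : g -> Prop) :
  Q 0 -> (forall a u v, Q u -> Q v -> Q (a *: u + v)) ->
  (forall u v, u \in U -> v \in V -> Q (lie u v)) ->
  forall w, w \in lie_span U V -> Q w.
Proof.
move=> Q0 QL QUV w; have [W WQ] := pred_vspace Q0 QL.
move=> wUV; apply/WQ/(subvP _ _ wUV); apply: lie_span_sub => u v uU vV.
exact/WQ/QUV.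
Qed.

Lemma semisimple_abelian_ideal I : semisimple g ->
  (forall x y, y \in I -> lie x y \in I) ->
  (forall x y, x \in I -> y \in I -> lie x y = 0) -> I = 0%VS.
Proof.
move=> ss Iid Iab; apply: ss; first by apply: lie_span_sub => x y _; apply: Iid.
exists 1%N; apply/eqP; rewrite -subv0 /=; apply: lie_span_sub => x y xI yI.
by rewrite Iab ?mem0v.
Qed.

Definition etr f : K := \tr (passmx.mxof (vbasis fullv) (vbasis fullv) f).

Fact etr_is_scalar : scalar etr.
Proof. by move=> a f h; rewrite /etr passmx.mxof_linear mxtraceD mxtraceZ. Qed.
HB.instance Definition _ := GRing.isLinear.Build K 'End(g) K *%R etr etr_is_scalar.

Lemma etrC f h : etr (f \o h)%VF = etr (h \o f)%VF.
Proof.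
have eP := vbasisP (fullv : {vspace g}).
by rewrite /etr !(passmx.mxof_comp _ _ eP) mxtrace_mulC.
Qed.

Lemma killingE x y : killing x y = etr (ad x \o ad y)%VF.
Proof. by []. Qed.

Lemma killingC x y : killing x y = killing y x.
Proof. exact: etrC. Qed.

Fact killing_is_scalar x : scalar (killing x).
Proof.
move=> a y z; rewrite !killingE linearP /= comp_lfunDr -comp_lfunZr.
by rewrite linearP.
Qed.
HB.instance Definition _ x :=
  GRing.isLinear.Build K g K *%R (killing x) (killing_is_scalar x).

Lemma killing_lie x y z : killing (lie x y) z = killing x (lie y z).
Proof.
rewrite !killingE !ad_lie comp_lfunDl comp_lfunDr comp_lfunNl comp_lfunNr.
rewrite !linearB /=; congr (_ - _); first by rewrite comp_lfunA.
by rewrite -comp_lfunA etrC comp_lfunA.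
Qed.

(* [J] is exhausted by growing a subalgebra [J'] one normalizing element at a
   time, which avoids quotient modules. *)
Lemma engel (J : {vspace g}) : (forall x y, x \in J -> y \in J -> lie x y \in J) ->
  (forall x, x \in J -> exists k, forall v, iter k (lie x) v = 0) ->
  forall U W, ~~ (W <= U)%VS ->
    (forall x u, x \in J -> u \in U -> lie x u \in U) ->
    (forall x w, x \in J -> w \in W -> lie x w \in W) ->
  exists w, [/\ w \in W, w \notin U & forall x, x \in J -> lie x w \in U].
Proof.
move=> Jalg Jnil.
(* Engel's theorem in relative form: [J'] kills a nonzero vector of [W / U] (when [W] lies in [U]
   there is nothing to find). *)
pose engel_for J' := forall U W, ~~ (W <= U)%VS ->
    (forall x u, x \in J' -> u \in U -> lie x u \in U) ->
    (forall x w, x \in J' -> w \in W -> lie x w \in W) ->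
  exists w, [/\ w \in W, w \notin U & forall x, x \in J' -> lie x w \in U].
rewrite -/(engel_for J).
suff grow m : exists J', [/\ (J' <= J)%VS,
    forall x y, x \in J' -> y \in J' -> lie x y \in J',
    engel_for J' & (J <= J')%VS \/ (m <= \dim J')%N].
  have [J' [J'J _ EJ' [JJ'|]]] := grow (\dim J).+1.
    by have -> : J = J' by apply/eqP; rewrite eqEsubv JJ'.
  by rewrite ltnNge dimvS.
elim: m => [|m [J' [J'J J'alg EJ' [JJ'|mJ']]]].
- exists 0%VS; split; rewrite ?sub0v //; last by right.
    by move=> x y; rewrite !memv0 => /eqP-> _; rewrite lie0l.
  move=> U W /subvPn[w wW wU] _ _; exists w; split=> // x.
  by rewrite memv0 => /eqP->; rewrite lie0l mem0v.
- by exists J'; split=> //; left.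
have [JJ'|JJ'] := boolP (J <= J')%VS; first by exists J'; split=> //; left.
(* With [U = J'] and [W = J], the relative form yields [z] outside [J'] with [[J', z]] inside
   [J']. *)
have [x y xJ' yJ|z [zJ zJ' J'z]] := EJ' _ _ JJ' J'alg.
  by apply: Jalg => //; apply: (subvP J'J).
have zJ'' : z \in (<[z]> + J')%VS.
  by rewrite -[X in X \in _]addr0 memv_add ?memv_line ?mem0v.
exists (<[z]> + J')%VS; split.
- by rewrite subv_add J'J -memvE zJ.
- move=> _ _ /memv_addP[_ /vlineP[a ->] [x xJ' ->]]
             /memv_addP[_ /vlineP[b ->] [y yJ' ->]].
  apply: (subvP (addvSr _ _)).
  rewrite lieDl !linearD /= !lieZl !linearZ /= lie_alt !scaler0 add0r.
  rewrite (lie_anti z y) scalerN.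
  by rewrite !rpredD ?rpredN ?rpredZ ?J'z ?J'alg.
- move=> U W WU KU KW.
  have J'K x : x \in J' -> x \in (<[z]> + J')%VS by apply/subvP/addvSr.
  have [x u /J'K|x w /J'K|w0 [w0W w0U J'w0]] := EJ' _ _ WU; [exact: KU|exact: KW|].
  have [k kz] := Jnil _ zJ.
  (* The last iterate of [z] on [w0] that is outside [U] is killed modulo [U] by [z], and also by
     [J'], because [z] normalizes [J']. *)
  have : exists k, iter k (lie z) w0 \in U by exists k; rewrite kz mem0v.
  move/ex_minnP=> [[|j]]; first by rewrite /= (negPf w0U).
  move=> jU jmin; exists (iter j (lie z) w0); split.
  + by elim: (j) => [|i IHi] //=; apply: KW.
  + by apply/negP=> /jmin; rewrite ltnn.
  + have J'w i x : x \in J' -> lie x (iter i (lie z) w0) \in U.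
      elim: i x => [|i IHi] x xJ' /=; first exact: J'w0.
      rewrite lie_lie rpredD //; last by apply: KU => //; apply: IHi.
      by apply: IHi; apply: J'z.
    move=> _ /memv_addP[_ /vlineP[a ->] [x xJ' ->]].
    by rewrite lieDl lieZl rpredD ?rpredZ // J'w.
- right; apply: leq_ltn_trans mJ' _.
  rewrite ltn_neqAle dimvS ?addvSr // andbT; apply: contra zJ' => /eqP dimE.
  by have /eqP -> : (J' == <[z]> + J')%VS by rewrite eqEdim addvSr dimE leqnn.
Qed.

End LieBasics.

(** * Nondegeneracy of the Killing form and existence of adjoints *)

Section Cartan.
Variables (C : numClosedFieldType) (g : lieAlgType C).
Implicit Types (x y z u v : g).

(* The generalized eigenspaces of ad x satisfy [g_a, g_b] <= g_(a + b). *)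
Lemma weight_lie x a b k l u v :
  iter k (fun w => ad x w - a *: w) u = 0 ->
  iter l (fun w => ad x w - b *: w) v = 0 ->
  iter (k + l) (fun w => ad x w - (a + b) *: w) (lie u v) = 0.
Proof.
have iterD n c w w' : iter n (fun w => ad x w - c *: w) (w + w') =
    iter n (fun w => ad x w - c *: w) w + iter n (fun w => ad x w - c *: w) w'.
  by elim: n => //= n ->; rewrite linearD scalerDr opprD addrACA.
have iter0 n c : iter n (fun w => ad x w - c *: w) 0 = 0.
  by elim: n => //= n ->; rewrite linear0 scaler0 subr0.
(* The number of iterations becomes any [m >= k + l]: the Leibniz rule gives two terms, each with
   one of the exponents lowered, and both are handled with [m - 1] iterations. *)
move: {2 3}(k + l)%N (leqnn (k + l)) => m.
elim: m k l u v => [|m IHm] [|k] [|l] u v // klm uk vl.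
- by rewrite (_ : u = 0) ?lie0l //; exact: uk.
- by rewrite (_ : u = 0) ?lie0l ?iter0 //; exact: uk.
- by rewrite (_ : u = 0) ?lie0l ?iter0 //; exact: uk.
- by rewrite (_ : v = 0) ?linear0 ?iter0 //; exact: vl.
rewrite iterSr.
have -> : ad x (lie u v) - (a + b) *: lie u v =
    lie (ad x u - a *: u) v + lie u (ad x v - b *: v).
  rewrite !adE lie_lie -!scaleNr lieDl lieZl lieDr lieZr.
  by rewrite opprD scalerDl addrACA.
have klm' : (k + l.+1 <= m)%N by [].
have lkm : (k.+1 + l <= m)%N by rewrite addSnnS.
rewrite iterSr in uk; rewrite iterSr in vl.
by rewrite iterD (IHm _ _ _ _ klm' uk) ?(IHm _ _ _ _ lkm _ vl) ?addr0 // iterSr.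
Qed.

(* The D of [conj_replica_End] is a derivation, so
   tr (ad [u, v] D) = - killing u (D v). *)
Lemma lie_radical_nilpotent (I : {vspace g}) :
  (forall u, u \in I -> forall v, killing u v = 0) ->
  forall x, x \in lie_span I fullv -> exists k, forall v, iter k (lie x) v = 0.
Proof.
move=> Irad x xI; have [D [Dweight Dind Dnil]] := conj_replica_End (ad x).
(* On generalized eigenvectors [D] multiplies by the conjugate weight, and weights add under the
   bracket as their conjugates do; the induction principle extends the rule first in [u], then in
   [v]. *)
have Dder u v : D (lie u v) = lie (D u) v + lie u (D v).
  move: u v; apply: (Dind (fun u => forall v, D (lie u v) = lie (D u) v + lie u (D v)))
    => [v|u u' IHu IHu' v|a k u uk].
  - by rewrite lie0l !linear0 !lie0l addr0.
  - by rewrite lieDl !linearD /= IHu IHu' !lieDl addrACA.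
  apply: (Dind (fun v => D (lie u v) = lie (D u) v + lie u (D v)))
    => [|v v' IHv IHv'|b l v vl].
  - by rewrite !linear0 addr0.
  - by rewrite !linearD /= IHv IHv' addrACA -linearD.
  rewrite (Dweight _ _ _ uk) (Dweight _ _ _ vl) (Dweight _ _ _ (weight_lie uk vl)).
  by rewrite lieZl linearZ /= rmorphD scalerDl.
suff /Dnil[k kx] : etr (ad x \o D)%VF = 0.
  exists k => v; rewrite -[RHS](kx v); apply: eq_iter => w; exact/esym/adE.
(* [D] is now a fixed derivation, detached from [x]; the trace is linear in [x], so it suffices to
   treat brackets. *)
move: x xI {Dweight Dind Dnil}.
apply: lie_span_ind => [|a x y xD yD|u v uI _].
- by rewrite linear0 comp_lfun0l linear0.
- by rewrite linearP /= comp_lfunDl -comp_lfunZl linearP /= xD yD mulr0 addr0.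
rewrite ad_lie comp_lfunDl comp_lfunNl linearB /= -!comp_lfunA.
rewrite [etr (ad v \o _)]etrC -comp_lfunA -linearB /= -comp_lfunNr -comp_lfunDr.
have -> : ((ad v \o D) - (D \o ad v))%VF = - ad (D v).
  apply/lfunP=> w; rewrite !lfunE /= !lfunE /= !lfunE /= !adE Dder.
  by rewrite opprD addrCA subrr addr0.
by rewrite comp_lfunNr linearN /= -killingE Irad // oppr0.
Qed.

Theorem killing_nondegenerate : semisimple g ->
  forall x, (forall y, killing x y = 0) -> x = 0.
Proof.
move=> ss.
have [//||I IP] := @pred_vspace _ g (fun x => forall y, killing x y = 0).
- by move=> y; rewrite killingC linear0.
- move=> a u v u0 v0 y; rewrite killingC linearP /= !(killingC y) u0 v0.
  by rewrite mulr0 addr0.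
have Irad u : u \in I -> forall v, killing u v = 0 by move=> /IP.
have Iideal x y : y \in I -> lie x y \in I.
  move=> yI; rewrite lie_anti rpredN; apply/IP => z.
  by rewrite killing_lie Irad.
have JI : (lie_span I fullv <= I)%VS.
  by apply: lie_span_sub => u v uI _; rewrite lie_anti rpredN Iideal.
have Jideal x y : y \in lie_span I fullv -> lie x y \in lie_span I fullv.
  move=> yJ; rewrite lie_anti rpredN; apply: mem_lie_span; last exact: memvf.
  exact: (subvP JI).
(* [Z] is the center of [[I, g]]; it is an abelian ideal of [g], by the Jacobi identity. *)
have [Z ZP] : exists Z : {vspace g}, forall w, w \in Z <->
    w \in lie_span I fullv /\ forall x, x \in lie_span I fullv -> lie x w = 0.
  apply: pred_vspace => [|a u v [uJ uZ] [vJ vZ]].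
    by split=> [|x _]; rewrite ?mem0v ?linear0.
  split=> [|x xJ]; first by rewrite rpredD ?rpredZ.
  by rewrite linearP /= uZ // vZ // scaler0 addr0.
have Z0 : Z = 0%VS.
  apply: semisimple_abelian_ideal => // x y /ZP[xJ xZ]; last by move=> /ZP[_]; apply.
  apply/ZP; split=> [|z zJ]; first exact: Jideal.
  by rewrite lie_lie (xZ _ zJ) linear0 addr0 xZ // lie_anti rpredN Jideal.
(* Engel's theorem for the action of [[I, g]] on itself, with [U = 0], would give a nonzero element
   of [Z]. *)
have J0 : lie_span I fullv = 0%VS.
  apply/eqP; rewrite -subv0; apply/negPn/negP => J0.
  have [x y _ yJ|||w [wJ w0 Jw]] := engel _ (lie_radical_nilpotent Irad) J0.
  - exact: Jideal.
  - by move=> x u _; rewrite !memv0 => /eqP->; rewrite linear0.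
  - by move=> x w _; apply: Jideal.
  suff : w \in Z by rewrite Z0 (negPf w0).
  by apply/ZP; split=> // x /Jw; rewrite memv0 => /eqP.
have I0 : I = 0%VS.
  apply: semisimple_abelian_ideal => // x y xI yI; apply/eqP.
  by rewrite -memv0 -J0 mem_lie_span ?memvf.
by move=> x x0; apply/eqP; rewrite -memv0 -I0; apply/IP.
Qed.

(** Nondegeneracy makes the Gram matrix [G] invertible, and the coordinates of [z] solve a linear
    system with matrix [G]. *)
Lemma killing_represents : semisimple g -> forall phi : {scalar g},
  exists z, forall y, phi y = killing z y.
Proof.
move=> ss phi; set e := vbasis (fullv : {vspace g}).
have eP : basis_of fullv e := vbasisP fullv.
pose G := \matrix_(i < \dim (fullv : {vspace g}), j < \dim (fullv : {vspace g}))
            killing e`_i e`_j.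
have GE w (j : 'I_(\dim (fullv : {vspace g}))) :
    killing (passmx.vecof e w) e`_j = (w *m G) 0 j.
  rewrite killingC linear_sum mxE; apply: eq_bigr => i _.
  by rewrite linearZ /= mxE killingC.
have ext (f h : {scalar g}) :
    (forall i : 'I_(\dim (fullv : {vspace g})), f e`_i = h e`_i) -> f =1 h.
  move=> fh y; rewrite (coord_vbasis (memvf y)) !linear_sum.
  by apply: eq_bigr => i _; rewrite !linearZ /= fh.
have Gu : G \in unitmx.
  rewrite -row_free_unit; apply: inj_row_free => v vG.
  apply/eqP; rewrite -(passmx.vecof_eq0 eP); apply/eqP.
  apply: killing_nondegenerate => // y.
  apply: (ext (killing (passmx.vecof e v)) (\0)) => i.
  by rewrite /= GE vG mxE.
exists (passmx.vecof e ((\row_j phi e`_j) *m invmx G)); apply: ext => i.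
by rewrite /= GE mulmxKV // mxE.
Qed.

(** Representing the forms [killing (f _) y] gives a candidate [h], linear by nondegeneracy; hence
    the default value in [adjoint] is never taken. *)
Lemma adjointP : semisimple g -> forall (f : 'End(g)) x y,
  killing (f x) y = killing x (adjoint f y).
Proof.
move=> ss f.
have /choice[h hP] y : exists z, forall x, killing (f x) y = killing x z.
  have lin : scalar (fun x => killing (f x) y).
    by move=> a u v; rewrite linearP killingC linearP /= !(killingC y).
  pose phi : {scalar g} := HB.pack (fun x => killing (f x) y)
    (GRing.isLinear.Build C g C *%R (fun x => killing (f x) y) lin).
  have [z zP] := killing_represents ss phi.
  by exists z => x; rewrite (killingC x) -zP.
have hlin : linear h.
  move=> a y z; apply/eqP; rewrite -subr_eq0; apply/eqP.
  apply: killing_nondegenerate => // x.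
  by rewrite killingC linearB linearP /= -!hP linearP subrr.
pose hl : {linear g -> g} := HB.pack h (GRing.isLinear.Build C g g *:%R h hlin).
rewrite /adjoint; case: xgetP => [_ _ //|/(_ (linfun hl))].
by case=> x y; rewrite lfunE hP.
Qed.

Lemma adjoint_linear : semisimple g -> linear (@adjoint C g).
Proof.
move=> ss a f h; apply/lfunP=> y; apply/eqP; rewrite -subr_eq0; apply/eqP.
apply: killing_nondegenerate => // x.
rewrite add_lfunE scale_lfunE killingC linearB linearP /= -!adjointP //.
rewrite add_lfunE scale_lfunE killingC linearP /= !(killingC y).
by rewrite subrr.
Qed.

Lemma adjointZ : semisimple g -> forall a (f : 'End(g)), adjoint (a *: f) = a *: adjoint f.
Proof.
move=> ss a f.
pose L : {linear 'End(g) -> 'End(g)} := HB.pack (@adjoint C g)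
  (GRing.isLinear.Build C 'End(g) 'End(g) *:%R (@adjoint C g) (adjoint_linear ss)).
by rewrite -[adjoint _]/(L _) linearZ.
Qed.

End Cartan.

(** * Asymptotic expansions at the origin *)

Section CoefExtraction.
Variable K : comNzRingType.

(* The power series (1 - X)^-(N + 1), truncated. *)
Let G N : {poly K} := \poly_(m < N.+1) ('C(N + m, m))%:R.

(** Up to degree [N] the product is the series [(1 - X)^(b - N - 1)]; each further factor [1 - 'X]
    takes differences of coefficients, which is Pascal's rule. *)
Let coefG N b m i : (m <= N)%N -> (b + i = N + m)%N ->
  (G N * (1 - 'X) ^+ b)`_m = ('C(i, m))%:R.
Proof.
elim: b m i => [|b IHb] m i mN; first by rewrite add0n expr0 mulr1 coef_poly ltnS mN => ->.
rewrite addSnnS => biE.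
rewrite exprSr mulrA mulrBr mulr1 coefB coefMX (IHb _ _ mN biE).
case: m mN biE => [|m] mN biE /=; first by rewrite !bin0 subr0.
rewrite (IHb m i (ltnW mN)); last by apply/eqP; rewrite -eqSS -addnS biE addnS.
by rewrite binS natrD addrK.
Qed.

(* The coefficient of X^q, q <= N, after division by (1 - X)^(N + 1). *)
Lemma coef_extraction (A B : nat -> K) (Q : {poly K}) N r q i :
  (q <= N)%N -> (r + i = N + q)%N ->
  'X ^+ N.+1 * Q - \sum_(a < r.+1) (A a)%:P * ('X ^+ a * (1 - 'X) ^+ (r - a))
    + (1 - 'X) ^+ N.+1 * \sum_(a < r.+1) (B a)%:P * 'X ^+ (r - a) = 0 ->
  \sum_(a < r.+1 | (a <= q)%N) A a *+ 'C(i, q - a) = if (q <= r)%N then B (r - q)%N else 0.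
Proof.
move=> qN riE eq0.
set p1 := \sum_(a < r.+1) _ in eq0; set p2 := \sum_(a < r.+1) _ in eq0.
have {eq0} p1E : p1 = 'X ^+ N.+1 * Q + (1 - 'X) ^+ N.+1 * p2.
  by apply/eqP; rewrite -subr_eq0 -oppr_eq0 -[X in _ == X]eq0; apply/eqP; ring.
(* Since [q <= N], the multiple of ['X ^+ N.+1] does not contribute, and [G N * (1 - 'X) ^+ N.+1]
   agrees with 1 up to degree [N]. *)
have : (G N * p1)`_q = p2`_q.
  rewrite p1E mulrDr coefD mulrCA coefXnM ltnS qN add0r mulrA coefM big_ord_recl.
  rewrite big1 ?addr0 => [|m _]; last first.
    rewrite lift0 (@coefG _ _ _ m) ?bin_small ?mul0r //; last by rewrite addSnnS.
    exact: leq_trans (ltn_ord m) qN.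
  rewrite subn0 -[X in X * _ = _](_ : 1 = _) ?mul1r //.
  rewrite coef0M coef_poly addn0 bin0 mul1r -horner_coef0 horner_exp !hornerE.
  by rewrite subr0 expr1n.
have -> : p2`_q = if (q <= r)%N then B (r - q)%N else 0.
  rewrite /p2 coef_sum; case: ifP => qr.
    have rq : (r - q < r.+1)%N by rewrite ltnS leq_subr.
    rewrite (bigD1 (Ordinal rq)) //= coefCM coefXn subKn // eqxx mulr1 big1 ?addr0 //.
    move=> a; rewrite -val_eqE /= => ar; rewrite coefCM coefXn.
    case: eqP => [qE|_]; last by rewrite mulr0.
    by rewrite qE subKn ?eqxx // -ltnS in ar.
  apply: big1 => a _; rewrite coefCM coefXn; case: eqP => [qE|_]; last by rewrite mulr0.
  by rewrite qE leq_subr in qr.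
move=> <-; rewrite /p1 mulr_sumr coef_sum big_mkcond; apply: eq_bigr => a _.
rewrite mulrCA coefCM mulrCA coefXnM ltnNge; case: leqP => [aq|qa] /=; last by rewrite mulr0.
rewrite (@coefG _ _ _ i) ?mulr_natr //; first by rewrite (leq_trans (leq_subr _ _)).
have ar : (a <= r)%N by rewrite -ltnS.
by rewrite addnBA // -riE addnBAC.
Qed.

End CoefExtraction.

Lemma poly_zero_on (K : numFieldType) (p : {poly K}) :
  (forall z, z != 0 -> z != 1 -> p.[z] = 0) -> p = 0.
Proof.
move=> p0; apply/eqP/negPn/negP => pn0.
(* The integers from 2 on avoid 0 and 1; [size p] of them are too many roots. *)
have := max_poly_roots pn0 (rs := [seq k.+2%:R | k <- iota 0 (size p)]).
rewrite size_map size_iota ltnn => /(_ _ _)/negP; apply=> //.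
  apply/allP=> _ /mapP[k _ ->]; apply/eqP/p0; first by rewrite pnatr_eq0.
  by rewrite -[1]/(1%:R) eqr_nat.
by rewrite map_inj_uniq ?iota_uniq // => k l /eqP; rewrite eqr_nat => /eqP[].
Qed.

Section Germs.
Variable C : numFieldType.
Implicit Types (P Q : C -> Prop) (h k : C -> C) (p q : {poly C}) (M : nat).

Definition near0 P := exists2 d : C, 0 < d & forall w, w != 0 -> `|w| < d -> P w.

Lemma near0S P Q : (forall w, w != 0 -> P w -> Q w) -> near0 P -> near0 Q.
Proof. by move=> PQ [d d0 dP]; exists d => // w w0 wd; apply: PQ => //; apply: dP. Qed.

Lemma near0_and P Q : near0 P -> near0 Q -> near0 (fun w => P w /\ Q w).
Proof.
(* The order is partial; [d * e / (d + e)] lies below both radii and serves as their minimum. *)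
move=> [d d0 dP] [e e0 eQ]; exists (d * e / (d + e)).
  by rewrite divr_gt0 ?mulr_gt0 ?addr_gt0.
move=> w w0 wde; split; [apply: dP => // | apply: eQ => //]; apply: lt_trans wde _.
  by rewrite ltr_pdivrMr ?addr_gt0 // ltr_pM2l // ltrDr.
by rewrite ltr_pdivrMr ?addr_gt0 // mulrC ltr_pM2l // ltrDl.
Qed.

Lemma near0_lt (e : C) : 0 < e -> near0 (fun w => `|w| < e).
Proof. by move=> e0; exists e. Qed.

Lemma near0_scale z P : z != 0 -> near0 P -> near0 (fun w => P (z * w)).
Proof.
move=> z0 [d d0 dP]; exists (d / `|z|); first by rewrite divr_gt0 ?normr_gt0.
move=> w w0 wd; apply: dP; first by rewrite mulf_neq0.
by rewrite normrM mulrC -ltr_pdivlMr ?normr_gt0.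
Qed.

Lemma near0_ex P : near0 P -> exists2 w, w != 0 & P w.
Proof.
move=> [d d0 dP]; exists (d / 2); first by rewrite gt_eqF // divr_gt0.
apply: dP; first by rewrite gt_eqF // divr_gt0.
by rewrite ger0_norm ?divr_ge0 ?ltW // ltr_pdivrMr // ltr_pMr // ltr1n.
Qed.

(** The expansion [h(w) = p(w) + O(w^M)] at 0; the coefficients of [p] from degree [M] on are not
    determined by it. *)
Definition appr M h p :=
  exists2 B, 0 <= B & near0 (fun w => `|h w - p.[w]| <= B * `|w| ^+ M).

Lemma appr_ext M h k p : near0 (fun w => h w = k w) -> appr M h p -> appr M k p.
Proof.
move=> hk [B B0 hp]; exists B => //.
by apply: near0S (near0_and hk hp) => w _ [->].
Qed.

Lemma appr_poly M p : appr M (horner p) p.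
Proof. by exists 0 => //; exists 1 => // w _ _; rewrite subrr normr0 mul0r. Qed.

Lemma apprD M h k p q : appr M h p -> appr M k q -> appr M (fun w => h w + k w) (p + q).
Proof.
move=> [B B0 hp] [B' B'0 kq]; exists (B + B'); first exact: addr_ge0.
apply: near0S (near0_and hp kq) => w _ [hw kw].
by rewrite hornerD opprD addrACA mulrDl (le_trans (ler_normD _ _)) // lerD.
Qed.

Lemma poly_bounded p : exists2 B, 0 <= B & forall w, `|w| < 1 -> `|p.[w]| <= B.
Proof.
exists (\sum_(i < size p) `|p`_i|) => [|w w1]; first by apply: sumr_ge0.
rewrite horner_coef (le_trans (ler_norm_sum _ _ _)) // ler_sum // => i _.
by rewrite normrM normrX ler_piMr // exprn_ile1 // ltW.
Qed.

Lemma appr_bounded M h p : appr M h p -> exists2 B, 0 <= B & near0 (fun w => `|h w| <= B).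
Proof.
move=> [B B0 hp]; have [B' B'0 pB] := poly_bounded p; exists (B + B'); first exact: addr_ge0.
apply: near0S (near0_and hp (near0_lt ltr01)) => w _ [hw w1].
rewrite -[h w](subrK p.[w]) (le_trans (ler_normD _ _)) // lerD ?pB //.
by rewrite (le_trans hw) // ler_piMr // exprn_ile1 // ltW.
Qed.

Lemma apprM M h k p q : appr M h p -> appr M k q -> appr M (fun w => h w * k w) (p * q).
Proof.
move=> hp kq; have [Bk Bk0 kB] := appr_bounded kq; have [Bp Bp0 pB] := poly_bounded p.
move: hp kq => [B B0 hp] [B' B'0 kq]; exists (B * Bk + Bp * B').
  by rewrite addr_ge0 ?mulr_ge0.
apply: near0S (near0_and (near0_and hp kq) (near0_and kB (near0_lt ltr01))).
move=> w _ [[hw kw] [kBw w1]].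
have -> : h w * k w - (p * q).[w] = (h w - p.[w]) * k w + p.[w] * (k w - q.[w]).
  by rewrite hornerM; ring.
rewrite [X in _ <= X]mulrDl (le_trans (ler_normD _ _)) // !normrM lerD //.
  by rewrite mulrAC ler_pM.
by rewrite -mulrA ler_pM // pB.
Qed.

Lemma appr_scale M h p z : z != 0 ->
  appr M h p -> appr M (fun w => h (z * w)) (p \Po (z *: 'X)).
Proof.
move=> z0 [B B0 hp]; exists (B * `|z| ^+ M); first by rewrite mulr_ge0 ?exprn_ge0.
apply: near0S (near0_scale z0 hp) => w _.
by rewrite horner_comp !hornerE normrM exprMn mulrA.
Qed.

Lemma coef_comp_scale p z (k : nat) : (p \Po (z *: 'X))`_k = z ^+ k * p`_k.
Proof.
rewrite comp_polyE coef_sum; under eq_bigr do rewrite exprZn !coefZ coefXn.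
have [kp|pk] := ltnP k (size p).
  rewrite (bigD1 (Ordinal kp)) //= eqxx mulr1 big1 ?addr0 1?mulrC // => i.
  by rewrite -val_eqE /= eq_sym => /negPf ->; rewrite !mulr0.
rewrite nth_default // mulr0 big1 // => i _.
by rewrite gtn_eqF ?mulr0 // (leq_trans (ltn_ord i)).
Qed.

(** Both [p.[w]] and [p.[w] - p]_0[are]O(w)[, so the constant]p[_0] is too, which forces it to be
    0. *)
Lemma appr0_coef0 M p : appr M.+1 (fun=> 0) p -> p`_0 = 0.
Proof.
move=> [B B0 p0]; apply/eqP/negPn/negP => pn0.
have [q pE] : exists q, p = q * 'X + (p`_0)%:P.
  have /factor_theorem[q qE] : root (p - (p`_0)%:P) 0.
    by rewrite /root !hornerE horner_coef0 subrr.
  by exists q; rewrite -['X]subr0 -qE subrK.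
have [B' B'0 qB] := poly_bounded q.
(* The added 1 keeps the divisor positive when both bounds are 0. *)
have BB : 0 < B + B' + 1 by rewrite ltr_wpDl ?addr_ge0.
have n0 : 0 < `|p`_0| by rewrite normr_gt0.
have := near0_and p0 (near0_and (near0_lt ltr01) (near0_lt (divr_gt0 n0 BB))).
move/near0_ex=> [w w0 [pw [w1 wlt]]].
have : `|p`_0| <= (B + B') * `|w|.
  have -> : p`_0 = (p.[w] - 0) - q.[w] * w by rewrite {2}pE !hornerE; ring.
  rewrite (le_trans (ler_normB _ _)) // mulrDl lerD //; last by rewrite normrM ler_pM // qB.
  rewrite distrC (le_trans pw) // exprS mulrA ler_piMr ?mulr_ge0 //.
  by rewrite exprn_ile1 // ltW.
apply/negP; rewrite -real_ltNge ?normr_real ?ger0_real ?mulr_ge0 ?addr_ge0 //.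
move: wlt; rewrite ltr_pdivlMr // => wlt; apply: le_lt_trans wlt.
by rewrite mulrC ler_wpM2l // lerDl.
Qed.

Lemma appr0_coef M p : appr M (fun=> 0) p -> forall k : nat, (k < M)%N -> p`_k = 0.
Proof.
move=> p0 k; elim: k M p p0 => [|k IHk] [|M] // p p0 kM; first exact: appr0_coef0 p0.
have [q pE] : exists q, p = q * 'X.
  have /factor_theorem[q qE] : root p 0 by rewrite /root horner_coef0 (appr0_coef0 p0).
  by exists q; rewrite -['X]subr0.
move: p0 => [B B0 p0]; rewrite pE coefMX /=; apply: (IHk M) => //; exists B => //.
apply: near0S p0 => w w0; rewrite pE !sub0r !normrN hornerM hornerX normrM exprSr mulrA.
by rewrite ler_pM2r // normr_gt0.
Qed.

End Germs.

(** * Finite-order expansions of vector-valued functions *)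

Section VectorGerms.
Variable C : numFieldType.
Implicit Types (U V W : vectType C) (M : nat).

(** The expansion of [f(w)] as the sum of the [w^k c_k] for [k < M], up to [O(w^M)]; testing on
    linear forms dispenses with a norm on [V], and [p] may depend on the form. *)
Definition vappr V M (f : C -> V) (c : nat -> V) :=
  forall phi : {scalar V}, exists2 p : {poly C},
    appr M (fun w => phi (f w)) p & forall k, (k < M)%N -> p`_k = phi (c k).

Lemma vappr_ext V M (f f' : C -> V) c c' :
  near0 (fun w => f w = f' w) -> (forall k, (k < M)%N -> c k = c' k) ->
  vappr M f c -> vappr M f' c'.
Proof.
move=> ff' cc' fc phi; have [p fp pc] := fc phi; exists p => [|k kM].
  by apply: appr_ext fp; apply: near0S ff' => w _ ->.
by rewrite pc // cc'.
Qed.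

Lemma vappr_scalel V M h p (v : V) :
  appr M h p -> vappr M (fun w => h w *: v) (fun k => p`_k *: v).
Proof.
move=> hp phi; exists (p * (phi v)%:P) => [|k _]; last by rewrite coefMC linearZ.
apply: appr_ext (apprM hp (appr_poly _ _)); exists 1 => // w _ _.
by rewrite linearZ hornerC.
Qed.

Lemma vappr_linear V W M (f : C -> V) c (L : {linear V -> W}) :
  vappr M f c -> vappr M (fun w => L (f w)) (fun k => L (c k)).
Proof.
move=> fc phi.
have lin : scalar (phi \o L) by move=> a u v; rewrite /= !linearP.
pose psi : {scalar V} := HB.pack (phi \o L)
  (GRing.isLinear.Build C V C *%R (phi \o L) lin).
exact: (fc psi).
Qed.

Lemma vapprD V M (f f' : C -> V) c c' : vappr M f c -> vappr M f' c' ->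
  vappr M (fun w => f w + f' w) (fun k => c k + c' k).
Proof.
move=> fc fc' phi; have [p fp pc] := fc phi; have [p' fp' pc'] := fc' phi.
exists (p + p') => [|k kM]; last by rewrite coefD linearD pc ?pc'.
by apply: appr_ext (apprD fp fp'); exists 1 => // w _ _; rewrite linearD.
Qed.

Lemma vapprZ V M (f : C -> V) c a : vappr M f c ->
  vappr M (fun w => a *: f w) (fun k => a *: c k).
Proof. exact: (vappr_linear (GRing.scale a)). Qed.

Lemma vappr_cst V (v : V) M : vappr M (fun=> v) (fun k => (k == 0%N)%:R *: v).
Proof.
apply: vappr_ext (vappr_scalel v (appr_poly M 1)).
  by exists 1 => // w _ _; rewrite hornerC scale1r.
by move=> k _; rewrite coef1.
Qed.

Lemma vappr_sum V M (I : Type) (r : seq I) (f : I -> C -> V) c :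
  (forall i, vappr M (f i) (c i)) ->
  vappr M (fun w => \sum_(i <- r) f i w) (fun k => \sum_(i <- r) c i k).
Proof.
move=> fc; elim: r => [|i r IHr].
  apply: vappr_ext (vappr_scalel 0 (appr_poly M 1)) => [|k _].
    by exists 1 => // w _ _; rewrite big_nil scaler0.
  by rewrite big_nil scaler0.
apply: vappr_ext (vapprD (fc i) IHr) => [|k _]; last by rewrite big_cons.
by exists 1 => // w _ _; rewrite big_cons.
Qed.

Lemma vappr_mul U V W M f c f' c' (phi : {scalar U}) (psi : {scalar V}) (w : W) :
  vappr M f c -> vappr M f' c' ->
  vappr M (fun t => (phi (f t) * psi (f' t)) *: w)
          (fun k => (\sum_(a < k.+1) phi (c a) * psi (c' (k - a)%N)) *: w).
Proof.
move=> /(_ phi)[p fp pc] /(_ psi)[q fq qc].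
apply: vappr_ext (vappr_scalel w (apprM fp fq)); first by exists 1.
move=> k kM; rewrite coefM; congr (_ *: _); apply: eq_bigr => a _.
by rewrite pc ?qc // (leq_ltn_trans _ kM) ?leq_subr // -ltnS.
Qed.

(** In coordinates, [b] is a sum of products of linear forms, for which the coefficients are those
    of a product of polynomials. *)
Lemma vappr_bilinear U V W M (b : U -> V -> W) f c f' c' :
  (forall u, linear (b u)) -> (forall v, linear (b^~ v)) ->
  vappr M f c -> vappr M f' c' ->
  vappr M (fun w => b (f w) (f' w))
          (fun k => \sum_(a < k.+1) b (c a) (c' (k - a)%N)).
Proof.
move=> br bl fc fc'.
pose e := vbasis (fullv : {vspace U}); pose e' := vbasis (fullv : {vspace V}).
have bE u v : b u v = \sum_i \sum_j (coord e i u * coord e' j v) *: b e`_i e'`_j.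
  pose bu u : {linear V -> W} :=
    HB.pack (b u) (GRing.isLinear.Build C V W *:%R (b u) (br u)).
  pose bv v : {linear U -> W} :=
    HB.pack (b^~ v) (GRing.isLinear.Build C U W *:%R (b^~ v) (bl v)).
  rewrite -[b u v]/(bv v u) {1}(coord_vbasis (memvf u)) linear_sum.
  apply: eq_bigr => i _; rewrite linearZ /= -[b _ v]/(bu _ v).
  rewrite {1}(coord_vbasis (memvf v)) linear_sum scaler_sumr.
  by apply: eq_bigr => j _; rewrite linearZ /= scalerA.
apply: vappr_ext (vappr_sum (index_enum _) (fun i => vappr_sum (index_enum _) (fun j =>
   vappr_mul (coord e i) (coord e' j) (b e`_i e'`_j) fc fc'))).
  by exists 1 => // w _ _; rewrite bE.
move=> k _; under [RHS]eq_bigr do rewrite bE.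
rewrite [RHS]exchange_big /=; apply: eq_bigr => i _.
rewrite [RHS]exchange_big /=; apply: eq_bigr => j _.
by rewrite scaler_suml.
Qed.

Lemma vappr_scale V M (f : C -> V) c z : z != 0 -> vappr M f c ->
  vappr M (fun w => f (z * w)) (fun k => z ^+ k *: c k).
Proof.
move=> z0 fc phi; have [p fp pc] := fc phi; exists (p \Po (z *: 'X)) => [|k kM].
  exact: (appr_scale z0 fp).
by rewrite coef_comp_scale pc // linearZ.
Qed.

(** Pointwise expansions suffice: an endomorphism [h] is the sum of the [L j (h e_j)], where [L j v]
    is the rank-one map sending [u] to [coord e j u *: v]. *)
Lemma vappr_End V M (f : C -> 'End(V)) (c : nat -> 'End(V)) :
  (forall x, vappr M (fun w => f w x) (fun k => c k x)) -> vappr M f c.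
Proof.
move=> fc; pose e := vbasis (fullv : {vspace V}).
have linE (j : 'I_(\dim (fullv : {vspace V}))) (v : V) : linear (fun u => coord e j u *: v).
  by move=> a u u'; rewrite linearP scalerDl scalerA.
pose E j v : {linear V -> V} := HB.pack (fun u => coord e j u *: v)
  (GRing.isLinear.Build C V V *:%R (fun u => coord e j u *: v) (linE j v)).
have linL (j : 'I_(\dim (fullv : {vspace V}))) : linear (fun v => linfun (E j v)).
  move=> a u v; apply/lfunP=> w; rewrite add_lfunE scale_lfunE !lfunE /=.
  by rewrite scalerDr !scalerA mulrC.
pose L j : {linear V -> 'End(V)} := HB.pack (fun v => linfun (E j v))
  (GRing.isLinear.Build C V 'End(V) *:%R (fun v => linfun (E j v)) (linL j)).
have LE (h : 'End(V)) : h = \sum_j L j (h e`_j).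
  apply/lfunP=> u; rewrite sum_lfunE {1}(coord_vbasis (memvf u)) linear_sum.
  by apply: eq_bigr => j _; rewrite lfunE /= linearZ.
apply: vappr_ext (vappr_sum (index_enum _) (fun j => vappr_linear (L j) (fc e`_j))).
  by exists 1 => // w _ _; rewrite -LE.
by move=> k _; rewrite -LE.
Qed.

Lemma vappr_unique V M (f : C -> V) c c' : vappr M f c -> vappr M f c' ->
  forall k, (k < M)%N -> c k = c' k.
Proof.
move=> fc fc' k kM; apply/eqP; rewrite -subr_eq0; apply/eqP.
have {fc fc'} d0 := vapprD fc (vapprZ (-1) fc').
rewrite [LHS](coord_vbasis (memvf _)) big1 // => i _.
have [p fp pc] := d0 (coord (vbasis fullv) i).
rewrite -scaleN1r -pc // (appr0_coef _ kM) ?scale0r //.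
by apply: appr_ext fp; exists 1 => // w _ _; rewrite scaleN1r subrr linear0.
Qed.

Lemma vappr0 V M (f : C -> V) c : near0 (fun w => f w = 0) -> vappr M f c ->
  forall k, (k < M)%N -> c k = 0.
Proof.
move=> f0 fc k kM.
have f0c : vappr M (fun=> 0) c.
  by apply: vappr_ext fc => //; apply: near0S f0 => w _ ->.
rewrite (vappr_unique f0c (vappr_cst 0 M) kM) scaler0 //.
Qed.

End VectorGerms.

(** * Laurent expansions *)

Section LaurentGerms.
Variable R : realType.
Local Notation C := R[i].

Lemma nbhs0_near0 (D : set C) : nbhs (0 : C^o) D -> near0 D.
Proof.
move=> /nbhs_ballP[e /= e0 eD]; exists e => // w _ we; apply: eD.
by rewrite -ball_normE /= sub0r normrN.
Qed.

Lemma cvg_dist (s : nat -> C) (l e : C) :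
  ((s : nat -> C^o) @ \oo --> (l : C^o)) -> 0 < e ->
  exists m0, forall m, (m0 <= m)%N -> `|s m - l| < e.
Proof.
move=> /cvgrPdist_lt /(_ e) sl /sl [m0 _ m0P]; exists m0 => m /m0P /=.
by rewrite distrC.
Qed.

Lemma geometric_sum_le (t : C) n : 0 <= t -> t <= 2^-1 -> \sum_(k < n) t ^+ k <= 2.
Proof.
move=> t0 t2; elim: n => [|n IHn]; first by rewrite big_ord0.
rewrite big_ord_recl expr0; under eq_bigr do rewrite lift0 exprS.
rewrite -mulr_sumr (_ : 2 = 1 + 2^-1 * 2); last by rewrite mulVf ?pnatr_eq0.
by rewrite lerD2l ler_pM // sumr_ge0 // => k _; rewrite exprn_ge0.
Qed.

(** Convergence at one point [u0] bounds the terms [h k * u0 ^+ k]; for [|u| < |u0| / 2] the tail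
    from [M] on is then dominated by a geometric series. *)
Lemma series_remainder (D : set C) (h : nat -> C) (A L : C -> C) M :
  near0 D ->
  (forall u, D u -> u != 0 ->
    (fun m => A u + \sum_(k < m) u ^+ k * h k : C^o) @ \oo --> (L u : C^o)) ->
  exists2 B, 0 <= B &
    near0 (fun u => `|L u - (A u + \sum_(k < M) u ^+ k * h k)| <= B * `|u| ^+ M).
Proof.
move=> D0 cvgL; have [u0 u00 Du0] := near0_ex D0.
have nu0 : 0 < `|u0| by rewrite normr_gt0.
have [B B0 hB] : exists2 B, 0 <= B & forall k, `|h k| * `|u0| ^+ k <= B.
  have [m0 m0P] := cvg_dist (cvgL _ Du0 u00) ltr01.
  (* From [m0] on, a term is the difference of two partial sums within 1 of the limit; the finite
     sum covers the earlier terms. *)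
  exists (2 + \sum_(k < m0) `|h k| * `|u0| ^+ k).
    by rewrite addr_ge0 ?sumr_ge0 // => k _; rewrite mulr_ge0 ?exprn_ge0.
  move=> k; have [km0|m0k] := ltnP k m0.
    rewrite (bigD1 (Ordinal km0)) //= addrCA lerDl addr_ge0 ?sumr_ge0 // => l _.
    by rewrite mulr_ge0 ?exprn_ge0.
  rewrite -[X in X <= _]addr0 lerD ?sumr_ge0 // => [|l _]; last first.
    by rewrite mulr_ge0 ?exprn_ge0.
  have := lerD (ltW (m0P _ (leqW m0k))) (ltW (m0P _ m0k)).
  apply: le_trans; rewrite mulrC -normrX -normrM big_ord_recr /=.
  set s := \sum_(i < k) _; set a := _ * h k.
  have {1}-> : a = (A u0 + (s + a) - L u0) - (A u0 + s - L u0).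
    by rewrite opprB addrA subrK addrA [_ + a]addrC addrK.
  exact: ler_normB.
(* The first summand bounds the tail; the 1 absorbs the distance from [L u] to a partial sum taken
   within [|u| ^+ M] of it. *)
exists (2 * B / `|u0| ^+ M + 1).
  by rewrite addr_ge0 ?divr_ge0 ?mulr_ge0 ?exprn_ge0.
apply: near0S (near0_and D0 (near0_lt (divr_gt0 nu0 (ltr0Sn _ 1)))) => u un0 [Du ulti].
have u_gt0 : 0 < `|u| ^+ M by rewrite exprn_gt0 ?normr_gt0.
have [m0 m0P] := cvg_dist (cvgL _ Du un0) u_gt0.
have /m0P := leq_addl M m0; set m := (M + m0)%N => mP.
pose t := `|u| / `|u0|.
have t0 : 0 <= t by rewrite divr_ge0.
have t2 : t <= 2^-1 by rewrite ler_pdivrMr // mulrC ltW.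
have utE k : `|u| ^+ k = t ^+ k * `|u0| ^+ k by rewrite -exprMn divfK ?gt_eqF.
rewrite (_ : _ - _ = (A u + \sum_(k < m) u ^+ k * h k - (A u + \sum_(k < M) u ^+ k * h k))
                     - (A u + \sum_(k < m) u ^+ k * h k - L u)); last first.
  by rewrite opprB [RHS]addrC addrA subrK.
rewrite (le_trans (ler_normB _ _)) // [X in _ <= X]mulrDl mul1r lerD ?(ltW mP) //.
rewrite big_split_ord /= addrA [X in `|X|]addrC addKr.
rewrite (le_trans (ler_norm_sum _ _ _)) //.
have -> : 2 * B / `|u0| ^+ M * `|u| ^+ M = t ^+ M * B * 2.
  by rewrite utE [X in _ * X]mulrC mulrA divfK ?expf_neq0 ?gt_eqF // -mulrA mulrC (mulrC B).
apply: (@le_trans _ _ (\sum_(i < m0) t ^+ M * B * t ^+ i)).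
  apply: ler_sum => i _.
  rewrite normrM normrX utE [X in X <= _]mulrC [X in X <= _]mulrCA.
  rewrite [X in _ <= X]mulrAC -exprD.
  by rewrite ler_wpM2l ?exprn_ge0.
rewrite -mulr_sumr ler_wpM2l ?mulr_ge0 ?exprn_ge0 //.
exact: geometric_sum_le.
Qed.

(** The Taylor coefficients of [u^(N+1) P_u]: the polar part appears reversed, from [T N] at index 0
    to [T 0] at index [N], followed by [H]. *)
Definition laurent_coef (V : Type) N (T H : nat -> V) (a : nat) : V :=
  if (a <= N)%N then T (N - a)%N else H (a - N.+1)%N.

Variable g : lieAlgType C.

Lemma laurent_partial_sum N (T H : nat -> 'End(g)) m (u : C) : u != 0 ->
  \sum_(k < N.+1) u ^- k.+1 *: T k + \sum_(k < m) u ^+ k *: H k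
  = u ^- N.+1 *: \sum_(a < N.+1 + m) u ^+ a *: laurent_coef N T H a.
Proof.
move=> u0; rewrite big_split_ord scalerDr !scaler_sumr; congr (_ + _).
  rewrite [RHS](reindex_inj rev_ord_inj); apply: eq_bigr => k _ /=.
  have kN : (k <= N)%N by rewrite -ltnS.
  rewrite /laurent_coef subSS leq_subr subKn // scalerA; congr (_ *: _).
  have -> : u ^+ N.+1 = u ^+ (N - k) * u ^+ k.+1 by rewrite -exprD addnS subnK.
  by rewrite invfM mulrAC mulVf ?expf_neq0 // mul1r.
apply: eq_bigr => k _; rewrite /laurent_coef /= ltnNge leq_addr /= addKn.
by rewrite scalerA exprD mulKf ?expf_neq0.
Qed.

Lemma laurent_vappr (D : set C) N T H (P : C -> 'End(g)) M :
  near0 D -> laurent_on D N T H P ->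
  vappr M (fun w => w ^+ N.+1 *: P w) (laurent_coef N T H).
Proof.
move=> D0 PTH; apply: vappr_End => x phi.
have linphi : linear (phi : g -> C^o) by move=> a u v; rewrite linearP.
pose psi : {linear g -> C^o} := HB.pack (phi : g -> C^o)
  (GRing.isLinear.Build C g C^o *:%R (phi : g -> C^o) linphi).
pose A w := \sum_(k < N.+1) w ^- k.+1 * phi (T k x).
(* With [N.+1 + M] terms this polynomial is [w ^+ N.+1] times the Laurent sum with [M] regular
   terms, so the remainder of [P] at order [M] bounds the error once [|w| < 1]. *)
exists (\poly_(a < N.+1 + M) phi (laurent_coef N T H a x)); last first.
  by move=> k kM; rewrite coef_poly (leq_trans kM) ?leq_addl.
have E u m : A u + \sum_(k < m) u ^+ k * phi (H k x) =
    phi ((\sum_(k < N.+1) u ^- k.+1 *: T k + \sum_(k < m) u ^+ k *: H k) x).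
  rewrite add_lfunE !sum_lfunE linearD !linear_sum /=; congr (_ + _);
    by apply: eq_bigr => k _; rewrite scale_lfunE linearZ.
have [u Du u0|B B0 rB] :=
    @series_remainder D (fun k => phi (H k x)) A (fun w => phi (P w x)) M D0.
  by rewrite (eq_cvg _ _ (E u)); exact: (PTH u Du u0 x psi).
exists B => //; apply: near0S (near0_and rB (near0_lt ltr01)) => w w0 [wB w1].
rewrite scale_lfunE linearZ /= horner_poly.
have -> : \sum_(i < N.+1 + M) phi (laurent_coef N T H i x) * w ^+ i
    = w ^+ N.+1 * (A w + \sum_(k < M) w ^+ k * phi (H k x)).
  rewrite E laurent_partial_sum // scale_lfunE linearZ /= mulVKf ?expf_neq0 //.
  rewrite sum_lfunE linear_sum.
  by apply: eq_bigr => k _; rewrite scale_lfunE linearZ /= mulrC.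
rewrite -mulrBr normrM; apply: le_trans wB.
by rewrite normrX ler_piMl // exprn_ile1 // ltW.
Qed.

End LaurentGerms.

(** * Expansion of the Yang-Baxter equation *)

Section LaurentCYBE.
Variables (R : realType) (g : lieAlgType R[i]).
Local Notation C := R[i].
Hypothesis ss : semisimple g.

Lemma vappr_app M (f : C -> 'End(g)) c (v : C -> g) d :
  vappr M f c -> vappr M v d ->
  vappr M (fun w => f w (v w)) (fun k => \sum_(a < k.+1) c a (d (k - a)%N)).
Proof.
apply: (@vappr_bilinear _ _ _ _ M (fun (f : 'End(g)) v => f v)) => [u|v' a u u'].
  exact: linearP.
by rewrite add_lfunE scale_lfunE.
Qed.

Lemma vappr_lie M (u v : C -> g) c d :
  vappr M u c -> vappr M v d ->
  vappr M (fun w => lie (u w) (v w)) (fun k => \sum_(a < k.+1) lie (c a) (d (k - a)%N)).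
Proof.
apply: vappr_bilinear => x a y z; [exact: lie_linearr | exact: lie_linearl].
Qed.

Lemma vappr_eval M (f : C -> 'End(g)) c (x : g) :
  vappr M f c -> vappr M (fun w => f w x) (fun k => c k x).
Proof.
have lin : linear (fun f : 'End(g) => f x).
  by move=> a u v; rewrite add_lfunE scale_lfunE.
pose L : {linear 'End(g) -> g} := HB.pack (fun f : 'End(g) => f x)
  (GRing.isLinear.Build C 'End(g) g *:%R (fun f : 'End(g) => f x) lin).
exact: (vappr_linear L).
Qed.

Lemma vappr_adjoint M (f : C -> 'End(g)) c :
  vappr M f c -> vappr M (fun w => adjoint (f w)) (fun k => adjoint (c k)).
Proof.
pose L : {linear 'End(g) -> 'End(g)} := HB.pack (@adjoint C g)
  (GRing.isLinear.Build C 'End(g) 'End(g) *:%R (@adjoint C g) (adjoint_linear ss)).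
exact: (vappr_linear L).
Qed.

Lemma vappr_liex M (v : C -> g) d (x : g) :
  vappr M v d -> vappr M (fun w => lie x (v w)) (fun k => lie x (d k)).
Proof. exact: (vappr_linear (lie x : {linear g -> g})). Qed.

Lemma vappr_liey M (v : C -> g) d (y : g) :
  vappr M v d -> vappr M (fun w => lie (v w) y) (fun k => lie (d k) y).
Proof.
pose L : {linear g -> g} := HB.pack (fun x => lie x y)
  (GRing.isLinear.Build C g g *:%R (fun x => lie x y) (lie_linearl y)).
exact: (vappr_linear L).
Qed.

Section Expansion.
Variables (D : set C) (n : nat) (P : C -> 'End(g)) (M : nat) (c : nat -> 'End(g)).
Hypotheses (D0 : near0 D) (PD : CYBE_on D P).
Hypothesis Pc : vappr M (fun w => w ^+ n *: P w) c.

(* The equation at u = (1 - z) w and v = z w, expanded at w = 0. *)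
Lemma cybe_expansion x y z r : z != 0 -> z != 1 -> (r < M)%N ->
  z ^+ n *: (\sum_(a < r.+1) (1 - z) ^+ (r - a) *: c a (lie x (adjoint (c (r - a)%N) y)))
  - \sum_(a < r.+1) (z ^+ a * (1 - z) ^+ (r - a)) *: c a (lie (c (r - a)%N x) y)
  + (1 - z) ^+ n *: (\sum_(a < r.+1) z ^+ (r - a) *: lie (c a x) (c (r - a)%N y)) = 0.
Proof.
move=> z0 z1 rM; have z1' : 1 - z != 0 by rewrite subr_eq0 eq_sym.
have Pz := vappr_scale z0 Pc; have Pz' := vappr_scale z1' Pc.
have E1 := vappr_app Pc (vappr_liex x (vappr_eval y (vappr_adjoint Pz'))).
have E2 := vappr_app Pz (vappr_liey y (vappr_eval x Pz')).
have E3 := vappr_lie (vappr_eval x Pc) (vappr_eval y Pz).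
(* The equation is multiplied by [z^n (1 - z)^n w^(2n)]. Each term contains two values of [P], which
   use up [w^(2n)] and part of the powers of [z] and [1 - z]; the outer scalars are what is left. *)
have := vapprD (vapprD (vapprZ (z ^+ n) E1) (vapprZ (-1) E2)) (vapprZ ((1 - z) ^+ n) E3).
move=> fc; apply: etrans (vappr0 _ fc rM).
  rewrite scaleN1r; congr (_ *: _ - _ + _ *: _); apply: eq_bigr => a _.
  - by rewrite adjointZ // scale_lfunE !linearZ.
  - by rewrite !scale_lfunE lieZl linearZ scalerA.
  - by rewrite scale_lfunE linearZ.
apply: near0S (near0_and (near0_and D0 (near0_scale z0 D0)) (near0_scale z1' D0)).
move=> w w0 [[Dw Dzw] Dzw'].
have wE : (1 - z) * w + z * w = w by rewrite -mulrDl subrK mul1r.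
have := PD Dzw' Dzw; rewrite wE => /(_ Dw (mulf_neq0 z1' w0) (mulf_neq0 z0 w0) w0 x y).
move=> /(congr1 (GRing.scale (z ^+ n * (1 - z) ^+ n * (w ^+ n * w ^+ n)))).
rewrite scaler0 => eq0; rewrite -[RHS]eq0 scalerDr scalerDr scalerN scaleN1r.
rewrite adjointZ // !scale_lfunE !linearZ /= !lieZl !linearZ /= !scalerA !exprMn.
by congr (_ *: _ + _ *: _ + _ *: _); ring.
Qed.

End Expansion.

(** With [k = j + m] this is the identity announced at the start. It is read off at order
    [r = 2N - (i + j)] in [w] and degree [q = N - j] in [z]; the last two conditions on [k] keep
    [i + j - k] between 0 and [N]. *)
Lemma cybe_residues (D : set C) (N : nat) (T H : nat -> 'End(g)) (P : C -> 'End(g)) :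
  near0 D -> CYBE_on D P -> laurent_on D N T H P ->
  forall x y i j, (j <= N)%N -> (i + j <= N + N)%N ->
  \sum_(k < N.+1 | [&& j <= k, k <= i + j & i + j <= N + k]%N)
     'C(i, k - j)%:R *: T k (lie (T (i + j - k)%N x) y)
  = if (i <= N)%N then lie (T i x) (T j y) else 0.
Proof.
move=> D0 PD PTH x y i j jN ijN.
pose c := laurent_coef N T H.
have Pc := laurent_vappr (N + N).+1 D0 PTH; rewrite -/c in Pc.
have [q [r [qN rN riE jE]]] : exists q r,
    [/\ (q <= N)%N, (r <= N + N)%N, (r + i = N + q)%N & (j = N - q)%N].
  exists (N - j)%N, (N + N - (i + j))%N; split; rewrite ?leq_subr ?subKn //; lia.
apply/eqP; rewrite -subr_eq0; apply/eqP; set d := (X in X = 0).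
rewrite [LHS](coord_vbasis (memvf d)) big1 // => l _.
suff -> : coord (vbasis fullv) l d = 0 by rewrite scale0r.
pose phi : {scalar g} := coord (vbasis fullv) l; rewrite -/(phi d) {}/d.
rewrite linearB linear_sum /=; apply/eqP; rewrite subr_eq0; apply/eqP.
pose A a := phi (c a (lie (c (r - a)%N x) y)).
pose B a := phi (lie (c a x) (c (r - a)%N y)).
pose Q := \sum_(a < r.+1)
  (phi (c a (lie x (adjoint (c (r - a)%N) y))))%:P * (1 - 'X) ^+ (r - a).
(* The indeterminate stands for [z]: the expanded equation holds at every [z] other than 0 and 1,
   hence as a polynomial identity. *)
have E0 : 'X ^+ N.+1 * Q - \sum_(a < r.+1) (A a)%:P * ('X ^+ a * (1 - 'X) ^+ (r - a))
    + (1 - 'X) ^+ N.+1 * \sum_(a < r.+1) (B a)%:P * 'X ^+ (r - a) = 0.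
  apply: poly_zero_on => z z0 z1.
  have := cybe_expansion D0 PD Pc x y z0 z1 (_ : (r < (N + N).+1)%N).
  rewrite ltnS => /(_ rN).
  move/(congr1 phi); rewrite linear0 linearD linearB !linearZ /= !(linear_sum phi) => <-.
  rewrite hornerD hornerD hornerN !hornerM !horner_sum hornerXn horner_exp.
  rewrite (_ : (1 - 'X).[z] = 1 - z); last by rewrite !hornerE.
  by congr (_ * _ - _ + _ * _); apply: eq_bigr => a _;
    rewrite !hornerE linearZ /= [RHS]mulrC ?mulrA.
have := coef_extraction qN riE E0; rewrite /A /B => {E0}.
have -> : (q <= r)%N = (i <= N)%N by apply/idP/idP; lia.
move=> E; transitivity (\sum_(a < N.+1 | (a <= q)%N && (a < r.+1)%N) A a *+ 'C(i, q - a)).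
  rewrite (reindex_inj rev_ord_inj) /= big_mkcond [RHS]big_mkcond; apply: eq_bigr => a _.
  have aN : (a <= N)%N by rewrite -ltnS.
  rewrite subSS; case: ifP => cond.
    have -> : ((a <= q) && (a < r.+1))%N by lia.
    rewrite /A /c /laurent_coef aN (_ : (r - a <= N)%N = true); last by lia.
    rewrite linearZ /= mulr_natl; congr (_ *+ 'C(_, _)); last by lia.
    by congr (phi (T _ (lie (T _ x) y))); lia.
  (* Only [k <= i + j] can fail here; then [q - a] exceeds [i] and the binomial coefficient is 0. *)
  case: ifP => // cond'; rewrite bin_small ?mulr0n //; lia.
transitivity (\sum_(a < r.+1 | (a <= q)%N) A a *+ 'C(i, q - a)).
  rewrite (big_ord_widen_cond (N.+1 + r.+1) (fun a => (a <= q)%N && (a < r.+1)%N)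
      (fun a => A a *+ 'C(i, q - a))) ?leq_addr //.
  rewrite (big_ord_widen_cond (N.+1 + r.+1) (fun a => (a <= q)%N)
      (fun a => A a *+ 'C(i, q - a))) ?leq_addl //.
  by apply: eq_bigl => a; lia.
rewrite E; case: ifP => iN; last by rewrite linear0.
have -> : (r - (r - q) = q)%N by lia.
have -> : (r - q = N - i)%N by lia.
by rewrite /c /laurent_coef leq_subr subKn // qN jE.
Qed.

End LaurentCYBE.

(** * Residues and the coefficients of [T_lambda] *)

Lemma vappr_mulXn (C : numFieldType) (V : vectType C) M n (f : C -> V) c :
  vappr M f c ->
  vappr M (fun w => w ^+ n *: f w) (fun k => if (k < n)%N then 0 else c (k - n)%N).
Proof.
move=> fc phi; have [p fp pc] := fc phi; exists ('X^n * p) => [|k kM].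
  apply: appr_ext (apprM (appr_poly M 'X^n) fp); exists 1 => // w _ _.
  by rewrite linearZ hornerXn.
by rewrite coefXnM; case: ifP => _; rewrite ?linear0 // pc // (leq_ltn_trans (leq_subr _ _)).
Qed.

Section Residue.
Variables (R : realType) (g : lieAlgType R[i]).
Local Notation C := R[i].

(** Two expansions may use different bounds [N] and [N'] on the pole order; after multiplication by
    [w^(N + N' + 2)] both residues are the coefficient of index [N + N' + 1], so uniqueness
    applies. *)
Lemma residue_laurent (D : set C) N T H (P : C -> 'End(g)) :
  nbhs (0 : C^o) D -> laurent_on D N T H P -> residue P = T 0%N.
Proof.
move=> D0 PTH; rewrite /residue; case: xgetP => [r _|/(_ (T 0%N))]; last first.
  by case; exists D, N, T, H.
move=> [D' [N' [T' [H' [D'0 PTH' ->]]]]].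
pose M := (N.+1 + N'.+1)%N.
have PN := vappr_mulXn N'.+1 (laurent_vappr M (nbhs0_near0 D0) PTH).
have PN' := vappr_mulXn N.+1 (laurent_vappr M (nbhs0_near0 D'0) PTH').
have MM : (N + N'.+1 < M)%N by rewrite /M addSn.
have E : near0 (fun w : C =>
    w ^+ N.+1 *: (w ^+ N'.+1 *: P w) = w ^+ N'.+1 *: (w ^+ N.+1 *: P w)).
  by exists 1 => // w _ _; rewrite !scalerA mulrC.
have := vappr_unique PN (vappr_ext E (fun _ _ => erefl) PN') MM.
have -> : (N + N'.+1 < N'.+1)%N = false by lia.
have -> : (N + N'.+1 < N.+1)%N = false by lia.
rewrite /laurent_coef addnK leqnn subnn.
have -> : (N + N'.+1 - N.+1 = N')%N by lia.
by rewrite leqnn subnn.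
Qed.

(** The bound [N] is kept and the coefficients move by [n] places, which brings [T n] to the
    position of the residue. *)
Lemma laurent_mulXn (D : set C) N T H (P : C -> 'End(g)) n (a : C) : (n <= N)%N ->
  laurent_on D N T H P ->
  exists T' H', T' 0%N = a *: T n /\ laurent_on D N T' H' (fun u => (u ^+ n * a) *: P u).
Proof.
move=> nN PTH.
pose c k := if (k < n)%N then 0 else a *: laurent_coef N T H (k - n)%N.
pose T' k := c (N - k)%N; pose H' k := c (N.+1 + k)%N.
exists T', H'; split.
  by rewrite /T' /c subn0 ltnNge nN /laurent_coef leq_subr subKn.
(* A partial sum with [m + n] regular terms for the product corresponds to one with [m] regular
   terms for [P]. *)
move=> u Du u0 x phi; rewrite -(cvg_shiftn n).
have linpsi : linear ((fun v => (u ^+ n * a) * phi v) : g -> C^o).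
  by move=> b v w; rewrite linearP mulrDr scalerAr.
pose psi : {linear g -> C^o} := HB.pack ((fun v => (u ^+ n * a) * phi v) : g -> C^o)
  (GRing.isLinear.Build C g C^o *:%R ((fun v => (u ^+ n * a) * phi v) : g -> C^o) linpsi).
have c'E k : laurent_coef N T' H' k = c k.
  rewrite /laurent_coef /T' /H'; case: leqP => kN; first by rewrite subKn.
  by rewrite subnKC.
have E m : phi ((\sum_(k < N.+1) u ^- k.+1 *: T' k + \sum_(k < m + n) u ^+ k *: H' k) x)
  = psi ((\sum_(k < N.+1) u ^- k.+1 *: T k + \sum_(k < m) u ^+ k *: H k) x).
  rewrite !laurent_partial_sum //= -[_ * phi _]linearZ -scale_lfunE.
  congr (phi (fun_of_lfun _ x)).
  rewrite [RHS]scalerA [X in _ = X *: _]mulrC -scalerA; congr (_ *: _).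
  rewrite (addnC m) addnCA big_split_ord /= big1 ?add0r => [|k _]; last first.
    by rewrite c'E /c ltn_ord scaler0.
  rewrite scaler_sumr; apply: eq_bigr => k _.
  by rewrite c'E /c ltnNge leq_addr /= addKn !scalerA exprD; congr (_ *: _); ring.
rewrite (eq_cvg _ _ E) scale_lfunE linearZ; exact: (PTH u Du u0 x psi).
Qed.

Lemma res_exp_laurent (D : set C) N T H (P : C -> 'End(g)) n :
  nbhs (0 : C^o) D -> laurent_on D N T H P -> (n <= N)%N ->
  res_exp P n = n`!%:R^-1 *: T n.
Proof.
move=> D0 PTH nN; have [T' [H' [<- PTH']]] := laurent_mulXn (n`!%:R^-1) nN PTH.
exact: residue_laurent PTH'.
Qed.

End Residue.

Lemma sum_mulrb (V : nmodType) N (F : nat -> V) (i : nat) :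
  \sum_(a < N.+1) F a *+ (i == a) = if (i <= N)%N then F i else 0.
Proof.
case: leqP => iN.
  rewrite (bigD1 (Ordinal (iN : (i < N.+1)%N))) //= eqxx big1 ?addr0 // => a.
  by rewrite -val_eqE /= eq_sym => /negPf ->.
by rewrite big1 // => a _; rewrite gtn_eqF // (leq_trans (ltn_ord a)).
Qed.

(** Multiplied by [(k - j)!], both sides equal [i! k!]. This turns the binomial of [(lambda + mu)^k]
    into the one of [cybe_residues]. *)
Lemma bin_fact_exchange i j k : (j <= k)%N -> (k <= i + j)%N ->
  ('C(k, j) * (i`! * j`!) = 'C(i, k - j) * (k`! * (i + j - k)`!))%N.
Proof.
move=> jk kij; have kji : (k - j <= i)%N by lia.
apply/eqP; rewrite -(eqn_pmul2r (fact_gt0 (k - j))); apply/eqP.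
transitivity (i`! * k`!)%N; first by rewrite -(bin_fact jk); ring.
by rewrite -(bin_fact kji) (_ : i - (k - j) = i + j - k)%N; [ring | lia].
Qed.

(** * Polynomial extension *)

Section PolynomialExtensionTheory.
Variables (K : fieldType) (g : lieAlgType K).
Local Notation A := {poly {poly K}}.
Local Notation n := (\dim (fullv : {vspace g})).
Local Notation e := (vbasis (fullv : {vspace g})).
Implicit Types (x y : g) (f : 'End(g)).

Lemma ext_inclE x i : ext_incl x 0 i = (coord e i x)%:P%:P.
Proof. by rewrite mxE. Qed.

Fact ext_incl_is_zmod : zmod_morphism (@ext_incl K g).
Proof. by move=> x y; apply/rowP=> i; rewrite !mxE linearB !polyCB. Qed.
HB.instance Definition _ :=
  GRing.isZmodMorphism.Build g (polyLie g) (@ext_incl K g) ext_incl_is_zmod.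

Lemma ext_inclZ a x : ext_incl (a *: x) = a%:P%:P *: ext_incl x.
Proof. by apply/rowP=> i; rewrite !mxE linearZ !polyCM. Qed.

Lemma ext_lin_sum (I : Type) (r : seq I) (l : I -> A) (a : I -> polyLie g) (f : g -> g) :
  ext_lin f (\sum_(i <- r) l i *: a i) = \sum_(i <- r) l i *: ext_lin f (a i).
Proof.
rewrite /ext_lin; under [RHS]eq_bigr do rewrite scaler_sumr.
rewrite [RHS]exchange_big; apply: eq_bigr => j _ /=.
rewrite summxE scaler_suml; apply: eq_bigr => i _.
by rewrite !mxE scalerA.
Qed.

Lemma ext_lin_incl f x : ext_lin f (ext_incl x) = ext_incl (f x).
Proof.
rewrite [in RHS](coord_vbasis (memvf x)) linear_sum raddf_sum; apply: eq_bigr => i _.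
by rewrite /= ext_inclE linearZ /= ext_inclZ.
Qed.

Lemma ext_lie_suml (I : Type) (r : seq I) (l : I -> A) (a : I -> polyLie g) b :
  ext_lie (\sum_(i <- r) l i *: a i) b = \sum_(i <- r) l i *: ext_lie (a i) b.
Proof.
rewrite /ext_lie; under [RHS]eq_bigr do rewrite scaler_sumr.
rewrite [RHS]exchange_big; apply: eq_bigr => j _.
under [RHS]eq_bigr do rewrite scaler_sumr.
rewrite [RHS]exchange_big; apply: eq_bigr => k _ /=.
rewrite summxE mulr_suml scaler_suml; apply: eq_bigr => i _.
by rewrite !mxE scalerA mulrA.
Qed.

Lemma ext_lie_sumr (I : Type) (r : seq I) (l : I -> A) (b : I -> polyLie g) a :
  ext_lie a (\sum_(i <- r) l i *: b i) = \sum_(i <- r) l i *: ext_lie a (b i).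
Proof.
rewrite /ext_lie; under [RHS]eq_bigr do rewrite scaler_sumr.
rewrite [RHS]exchange_big; apply: eq_bigr => j _.
under [RHS]eq_bigr do rewrite scaler_sumr.
rewrite [RHS]exchange_big; apply: eq_bigr => k _ /=.
rewrite summxE mulr_sumr scaler_suml; apply: eq_bigr => i _.
by rewrite !mxE scalerA mulrCA.
Qed.

Lemma ext_lie_incl x y : ext_lie (ext_incl x) (ext_incl y) = ext_incl (lie x y).
Proof.
rewrite [in RHS](coord_vbasis (memvf x)) lie_suml raddf_sum; apply: eq_bigr => i _.
rewrite [in RHS](coord_vbasis (memvf y)) linear_sum raddf_sum; apply: eq_bigr => j _.
by rewrite /= lieZl linearZ /= !ext_inclZ !ext_inclE scalerA.
Qed.

(** The degree [j] in the outer variable [mu] selects a single term of the binomial expansion. *)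
Lemma coef_lambda_mu (k m i j : nat) (v : K) :
  ((lambda K + mu K) ^+ k * lambda K ^+ m * v%:P%:P)`_j`_i
  = v *+ (if (j <= k) && (i == k - j + m) then 'C(k, j) else 0)%N.
Proof.
have -> : (lambda K + mu K) ^+ k * lambda K ^+ m =
    \poly_(b < k.+1) ('X^(k - b + m) *+ 'C(k, b)).
  rewrite poly_def exprDn mulr_suml; apply: eq_bigr => b _.
  by rewrite mulrnAl mulrAC -exprD /lambda -polyC_exp -mulrnAl -polyCMn mul_polyC.
rewrite !coefMC coef_poly ltnS; case: leqP => jk /=; last by rewrite coef0 mul0r mulr0n.
rewrite coefMn coefXn; case: eqP => _; last by rewrite mul0rn mul0r mulr0n.
by rewrite mulr_natl.
Qed.

Lemma coef_lambda_mu_monomial (k m i j : nat) (v : K) :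
  ((lambda K ^+ k * mu K ^+ m) * v%:P%:P)`_j`_i
  = v *+ ((j == m) && (i == k))%N.
Proof.
rewrite !coefMC /lambda -polyC_exp coefCM coefXn; case: eqP => _ /=.
  by rewrite mulr1 coefXn mulr_natl.
by rewrite mulr0 coef0 mul0r.
Qed.

End PolynomialExtensionTheory.

Theorem theorem1 (R : realType) (g : lieAlgType R[i]) (hg : semisimple g)
    (D : set R[i]) (hD : nbhs (0 : R[i]^o) D)
    (N : nat) (P : R[i] -> 'End(g))
    (hmero : meromorphic_on D N P) (hcybe : CYBE_on D P) :
  let T (l : {poly {poly R[i]}}) : polyLie g -> polyLie g :=
    ext_poly (res_exp P) N l in
  let lam := lambda R[i] in
  let mu := mu R[i] in
  forall x y : g,
    T (lam + mu) (ext_lie (T lam (ext_incl x)) (ext_incl y))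
    = ext_lie (T lam (ext_incl x)) (T mu (ext_incl y)).
Proof.
move=> T lam mu x y; rewrite {}/T {}/lam {}/mu.
have [T [H PTH]] := hmero.
have tE k : (k <= N)%N -> res_exp P k = k`!%:R^-1 *: T k := res_exp_laurent hD PTH.
have incl l z : ext_poly (res_exp P) N l (ext_incl z)
    = \sum_(k < N.+1) l ^+ k *: ext_incl (res_exp P k z).
  by apply: eq_bigr => k _; rewrite ext_lin_incl.
rewrite !incl ext_lie_suml; under eq_bigr do rewrite ext_lie_incl.
rewrite ext_lie_suml; under [RHS]eq_bigr do rewrite ext_lie_sumr.
rewrite /ext_poly; under [LHS]eq_bigr do rewrite ext_lin_sum scaler_sumr.
apply/rowP=> l; apply/polyP=> j; apply/polyP=> i.
pose phi : {scalar g} := coord (vbasis fullv) l.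
have inclE v : ext_incl v 0 l = (phi v)%:P%:P by rewrite mxE.
pose t k m := phi (T k (lie (T m x) y)).
have nat_unit k : (k`!%:R : R[i]) != 0 by rewrite pnatr_eq0 -lt0n fact_gt0.
(* The coefficient of [lambda^i mu^j] on the left is the left side of [cybe_residues] divided by
   [i! j!]; for each [k] only [m = i + j - k] contributes. *)
transitivity (\sum_(k < N.+1 | [&& j <= k, k <= i + j & i + j <= N + k]%N)
    (i`! * j`!)%:R^-1 * ('C(i, k - j)%:R * t k (i + j - k)%N)).
  rewrite summxE 2!coef_sum [RHS]big_mkcond; apply: eq_bigr => k _ /=.
  have kN : (k <= N)%N by rewrite -ltnS.
  rewrite summxE 2!coef_sum.
  have step m : (m <= N)%N ->
     (((lambda R[i] + mu R[i]) ^+ k *: (lambda R[i] ^+ m *: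
        ext_lin (res_exp P k) (ext_incl (lie (res_exp P m x) y)))) 0 l)`_j`_i
     = (k`!%:R^-1 * m`!%:R^-1 * t k m)
        *+ (if (j <= k) && (i == k - j + m) then 'C(k, j) else 0)%N.
    move=> mN; rewrite scalerA ext_lin_incl mxE inclE coef_lambda_mu.
    by rewrite !tE // !scale_lfunE lieZl !linearZ /= mulrA /t.
  under eq_bigr => m _ do rewrite (step _ (leq_ord m)).
  case: ifP => [/and3P[jk kij ijN]|cond]; last first.
    rewrite big1 // => m _; have := ltn_ord m; rewrite ltnS => mN.
    by rewrite (_ : _ && _ = false) ?mulr0n //; lia.
  transitivity (\sum_(m < N.+1)
      (k`!%:R^-1 * m`!%:R^-1 * t k m *+ 'C(k, j)) *+ ((i + j - k)%N == m)).
    apply: eq_bigr => m _; rewrite jk /= -mulrnA; congr (_ *+ _).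
    rewrite (_ : (i == k - j + m)%N = (i + j - k == m)%N); last by lia.
    by case: ifP; rewrite ?muln1 ?muln0.
  rewrite (sum_mulrb _ (fun m => k`!%:R^-1 * m`!%:R^-1 * t k m *+ 'C(k, j))).
  rewrite (_ : (i + j - k <= N)%N); last by lia.
  have binE : 'C(k, j)%:R * (k`!%:R^-1 * (i + j - k)`!%:R^-1)
      = (i`! * j`!)%:R^-1 * 'C(i, k - j)%:R :> R[i].
    rewrite -invfM [RHS]mulrC; apply/eqP.
    rewrite eqr_div ?mulf_neq0 ?nat_unit //; last by rewrite natrM mulf_neq0.
    by rewrite -!natrM bin_fact_exchange.
  by rewrite -mulr_natl mulrA binE mulrA.
rewrite -mulr_sumr.
rewrite summxE 2!coef_sum.
have step a : (a <= N)%N ->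
   ((lambda R[i] ^+ a *: \sum_(b < N.+1) mu R[i] ^+ b *:
     ext_lie (ext_incl (res_exp P a x)) (ext_incl (res_exp P b y))) 0 l)`_j`_i
   = (if (j <= N)%N then a`!%:R^-1 * j`!%:R^-1 * phi (lie (T a x) (T j y)) else 0)
      *+ (i == a).
  move=> aN; rewrite scaler_sumr summxE 2!coef_sum.
  rewrite -(sum_mulrb _ (fun b => a`!%:R^-1 * b`!%:R^-1 * phi (lie (T a x) (T b y)))).
  rewrite -sumrMnl; apply: eq_bigr => b _; have bN := leq_ord b.
  rewrite scalerA ext_lie_incl mxE inclE coef_lambda_mu_monomial -mulrnA mulnb.
  by rewrite !tE // !scale_lfunE lieZl !linearZ /= mulrA.
under [RHS]eq_bigr => a _ do rewrite (step _ (leq_ord a)).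
rewrite (sum_mulrb _ (fun a =>
  if (j <= N)%N then a`!%:R^-1 * j`!%:R^-1 * phi (lie (T a x) (T j y)) else 0)).
(* Outside the range of [cybe_residues] both sides vanish: no [k <= N] is admissible if [j > N] or
   [i + j > 2N], and in the second case with [j <= N] one has [i > N]. *)
case: (leqP j N) => jN; last first.
  rewrite big_pred0 ?mulr0 ?if_same // => k; have := leq_ord k; lia.
case: (leqP (i + j) (N + N)) => ijN; last first.
  rewrite big_pred0 ?mulr0; last by move=> k; have := leq_ord k; lia.
  by rewrite leqNgt (_ : (N < i)%N) //; lia.
have := cybe_residues hg (nbhs0_near0 hD) hcybe PTH x y jN ijN.
move/(congr1 phi); rewrite linear_sum /= => E.
rewrite (eq_bigr _ (fun k _ => esym (linearZ _ _))) E.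
case: leqP => iN; last by rewrite linear0 mulr0.
by rewrite natrM invfM.
Qed.
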